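(* Let $p$ be a prime, $n\ge2$, $C=(p,\dots,p)$ ($n$ entries), and let $\psi,\psi'$ be the characters attached to integers $\psi_1,\dots,\psi_n$ and $\psi'_1,\dots,\psi'_n$ with $p\nmid\psi_j\psi'_j$ for $1\le j\le n$, such that the Kloosterman sum $\mathrm{Kl}_p(\psi,\psi',C^{\ast}w_{\ast})$ is well-defined. Then $$\mathrm{Kl}_p(\psi,\psi',C^{\ast}w_{\ast})=p^{n-1}+p^{n-2}.$$
   Context: Let $G=\mathrm{GL}(n+1)$, $T$ the diagonal torus, $U$ the group of upper triangular unipotent matrices, $U^\top$ the lower triangular unipotent matrices. For $u\in U$ and $1\le i\le j\le n$, $u_{ij}$ denotes the entry of $u$ in row $i$ and column $j+1$, so $u_{jj}$ is the $j$-th superdiagonal entry. $e$ denotes the standard additive character of $\mathbb{Q}_p/\mathbb{Z}_p$ (so $e(x)=\exp(2\pi i x)$ for $x\in\mathbb{Z}[1/p]$). For integers $\psi_j,\psi_j'$ put $\psi(u)=e(\sum_{j=1}^n\psi_ju_{jj})$ and $\psi'(u)=e(\sum_{j=1}^n\psi'_ju_{jj})$. Kloosterman sums: for a signed permutation matrix $w$ put $U_w=U\cap w^{-1}U^\top w$ and $\bar U_w=U\cap w^{-1}Uw$. For $N=tw$ with $t\in T(\mathbb{Q}_p)$ put $C(N)=U(\mathbb{Q}_p)NU(\mathbb{Q}_p)\cap G(\mathbb{Z}_p)$ and $X(N)=U(\mathbb{Z}_p)\backslash C(N)/U_w(\mathbb{Z}_p)$. Each $x\in C(N)$ is uniquely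 $x=u(x)Nu'(x)$ with $u(x)\in U(\mathbb{Q}_p)$, $u'(x)\in U_w(\mathbb{Q}_p)$; this induces maps $u:X(N)\to U(\mathbb{Z}_p)\backslash U(\mathbb{Q}_p)$ and $u':X(N)\to U_w(\mathbb{Q}_p)/U_w(\mathbb{Z}_p)$, and $$\mathrm{Kl}_p(\psi,\psi',N)=\sum_{x\in X(N)}\psi(u(x))\,\psi'(u'(x)).$$ The Kloosterman sum is called well-defined if $\psi(NvN^{-1})=\psi'(v)$ for all $v\in\bar U_w(\mathbb{Q}_p)$. $w_{\ast}$ is the $(n+1)\times(n+1)$ matrix $\begin{pmatrix}&&(-1)^n\\&-I_{n-1}&\\1&&\end{pmatrix}$. For $C=(p^{r_1},\dots,p^{r_n})$, $C^{\ast}=\mathrm{diag}(p^{-r_1},p^{r_1-r_2},\dots,p^{r_{n-1}-r_n},p^{r_n})$; here all $r_k=1$, so $C^{\ast}=\mathrm{diag}(p^{-1},1,\dots,1,p)$. *)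

(* Defs.v *)
From HB Require Import structures.
From mathcomp Require Import all_boot all_order all_algebra.
From mathcomp Require Import complex.
From mathcomp Require Import all_classical all_reals all_analysis.

Set Implicit Arguments.
Unset Strict Implicit.
Unset Printing Implicit Defensive.

Import Order.TTheory GRing.Theory Num.Theory.
Local Open Scope classical_set_scope.
Local Open Scope ring_scope.

Lemma Zp_mod_natD (m M : nat) (a b : 'Z_M) : (1 < m)%N -> (1 < M)%N ->
  (m %| M)%N -> (nat_of_ord (a + b)%R)%:R = a%:R + b%:R :> 'Z_m.
Proof.
move=> m1 M1 dmM; rewrite -natrD -[LHS]Zp_nat_mod // -[RHS]Zp_nat_mod //.
by congr (_%:R); rewrite /= modn_dvdm // Zp_cast.
Qed.

Lemma Zp_mod_natM (m M : nat) (a b : 'Z_M) : (1 < m)%N -> (1 < M)%N ->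
  (m %| M)%N -> (nat_of_ord (a * b)%R)%:R = a%:R * b%:R :> 'Z_m.
Proof.
move=> m1 M1 dmM; rewrite -natrM -[LHS]Zp_nat_mod // -[RHS]Zp_nat_mod //.
by congr (_%:R); rewrite /= modn_dvdm // Zp_cast.
Qed.

(* Z_p is the inverse limit of the rings Z/p^(k+1), k >= 0; starting at
   exponent 1 keeps all the moduli above 1, as 'Z_ requires. The proof of
   primality is a parameter of the type because the ring structures use it. *)
Record padic_int (p : nat) (p_pr : prime p) := PadicInt {
  padic_res :> forall k : nat, 'Z_(p ^ k.+1);
  padic_compat : forall k : nat,
    (nat_of_ord (padic_res k.+1))%:R = padic_res k }.

Section PadicIntRing.
Context (p : nat) (p_pr : prime p).
Local Notation Zp := (padic_int p_pr).

Lemma pexpn_gt1 k : (1 < p ^ k.+1)%N.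
Proof. by rewrite -{1}(exp1n k.+1) ltn_exp2r // prime_gt1. Qed.

Lemma padic_intP (x y : Zp) : (forall k, x k = y k) -> x = y.
Proof.
case: x y => [x xP] [y yP] /= xy.
have {}xy : x = y by apply: functional_extensionality_dep.
by case: y / xy yP => yP; congr PadicInt; apply: Prop_irrelevance.
Qed.

HB.instance Definition _ := gen_eqMixin Zp.
HB.instance Definition _ := gen_choiceMixin Zp.

Lemma padic_cst_compat (a : int) (k : nat) :
  (nat_of_ord (a%:~R : 'Z_(p ^ k.+2)))%:R = a%:~R :> 'Z_(p ^ k.+1).
Proof.
have nat_case (n : nat) :
    (nat_of_ord (n%:R : 'Z_(p ^ k.+2)))%:R = n%:R :> 'Z_(p ^ k.+1).
  rewrite val_Zp_nat ?pexpn_gt1 // -[LHS]Zp_nat_mod ?pexpn_gt1 //.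
  by rewrite modn_dvdm ?Zp_nat_mod ?pexpn_gt1 // dvdn_exp2l.
case: a => n; first exact: nat_case.
rewrite NegzE !mulrNz -!pmulrn; apply/eqP; rewrite -subr_eq0 opprK.
rewrite -(nat_case n.+1) -Zp_mod_natD ?pexpn_gt1 ?dvdn_exp2l //.
by rewrite addNr.
Qed.

Definition padic_cst (a : int) : Zp := PadicInt p_pr (padic_cst_compat a).

Lemma padic_add_compat (x y : Zp) (k : nat) :
  (nat_of_ord (x k.+1 + y k.+1)%R)%:R = x k + y k.
Proof.
by rewrite Zp_mod_natD ?pexpn_gt1 ?dvdn_exp2l // !padic_compat.
Qed.

Lemma padic_mul_compat (x y : Zp) (k : nat) :
  (nat_of_ord (x k.+1 * y k.+1)%R)%:R = x k * y k.
Proof.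
by rewrite Zp_mod_natM ?pexpn_gt1 ?dvdn_exp2l // !padic_compat.
Qed.

Lemma padic_opp_compat (x : Zp) (k : nat) :
  (nat_of_ord (- x k.+1)%R)%:R = - x k.
Proof.
apply/eqP; rewrite -subr_eq0 opprK -(padic_compat x k).
rewrite -Zp_mod_natD ?pexpn_gt1 ?dvdn_exp2l //.
by rewrite addNr.
Qed.

Definition padic_add (x y : Zp) : Zp := PadicInt p_pr (padic_add_compat x y).
Definition padic_mul (x y : Zp) : Zp := PadicInt p_pr (padic_mul_compat x y).
Definition padic_opp (x : Zp) : Zp := PadicInt p_pr (padic_opp_compat x).

Lemma padic_addA : associative padic_add.
Proof. by move=> x y z; apply: padic_intP => k /=; rewrite addrA. Qed.
Lemma padic_addC : commutative padic_add.
Proof. by move=> x y; apply: padic_intP => k /=; rewrite addrC. Qed.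
Lemma padic_add0 : left_id (padic_cst 0) padic_add.
Proof. by move=> x; apply: padic_intP => k /=; rewrite mulr0z add0r. Qed.
Lemma padic_addN : left_inverse (padic_cst 0) padic_opp padic_add.
Proof. by move=> x; apply: padic_intP => k /=; rewrite mulr0z addNr. Qed.

HB.instance Definition _ :=
  GRing.isZmodule.Build Zp padic_addA padic_addC padic_add0 padic_addN.

Lemma padic_mulA : associative padic_mul.
Proof. by move=> x y z; apply: padic_intP => k /=; rewrite mulrA. Qed.
Lemma padic_mulC : commutative padic_mul.
Proof. by move=> x y; apply: padic_intP => k /=; rewrite mulrC. Qed.
Lemma padic_mul1 : left_id (padic_cst 1) padic_mul.
Proof. by move=> x; apply: padic_intP => k /=; rewrite mulr1z mul1r. Qed.
Lemma padic_mulD : left_distributive padic_mul +%R.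
Proof. by move=> x y z; apply: padic_intP => k /=; rewrite mulrDl. Qed.
Lemma padic_1neq0 : padic_cst 1 != 0.
Proof.
apply/eqP => /(congr1 (fun x : Zp => x 0%N)) /= /eqP.
by rewrite mulr1z mulr0z oner_eq0.
Qed.

HB.instance Definition _ := GRing.Zmodule_isComNzRing.Build Zp
  padic_mulA padic_mulC padic_mul1 padic_mulD padic_1neq0.

Lemma padic_resD (x y : Zp) k : (x + y) k = x k + y k. Proof. by []. Qed.
Lemma padic_resM (x y : Zp) k : (x * y) k = x k * y k. Proof. by []. Qed.
Lemma padic_resN (x : Zp) k : (- x) k = - x k. Proof. by []. Qed.
Lemma padic_res0 k : (0 : Zp) k = 0. Proof. exact: mulr0z. Qed.
Lemma padic_res1 k : (1 : Zp) k = 1. Proof. exact: mulr1z. Qed.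

Definition padic_unit : {pred Zp} := fun x => `[< exists y : Zp, y * x = 1 >].
Definition padic_inv (x : Zp) : Zp := xget x [set y | y * x = 1].

Lemma padic_mulVx : {in padic_unit, left_inverse 1 padic_inv *%R}.
Proof. by move=> x /asboolP; apply: xgetPex. Qed.
Lemma padic_unitP (x y : Zp) : y * x = 1 -> padic_unit x.
Proof. by move=> yx; apply/asboolP; exists y. Qed.
Lemma padic_inv_out : {in [predC padic_unit], padic_inv =1 id}.
Proof. by move=> x /asboolPn nx; apply: xgetPN => y yx; apply: nx; exists y. Qed.

HB.instance Definition _ := GRing.ComNzRing_hasMulInverse.Build Zp
  padic_mulVx padic_unitP padic_inv_out.

Lemma padic_res_eq0 (x : Zp) k : (x k == 0) = (p ^ k.+1 %| x k)%N.
Proof.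
rewrite -val_eqE /= /dvdn modn_small //.
by have := ltn_ord (x k); rewrite [X in (_ < X)%N -> _]Zp_cast ?pexpn_gt1.
Qed.

Lemma padic_res_mod (x : Zp) k l : x (k + l)%N = x k %[mod p ^ k.+1].
Proof.
elim: l => [|l IHl]; first by rewrite addn0.
rewrite addnS -IHl -(padic_compat x (k + l)) val_Zp_nat ?pexpn_gt1 //.
by rewrite modn_dvdm // dvdn_exp2l // ltnS leq_addr.
Qed.

Lemma padic_int_idomain (x y : Zp) : x * y = 0 -> (x == 0) || (y == 0).
Proof.
move=> xy0; apply/orP.
have [|/existsNP [k /eqP xk]] := pselect (forall k, x k = 0).
  by move=> x0; left; apply/eqP/padic_intP => k; rewrite x0 padic_res0.
have [|/existsNP [l /eqP yl]] := pselect (forall l, y l = 0).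
  by move=> y0; right; apply/eqP/padic_intP => l; rewrite y0 padic_res0.
exfalso; pose m := (k + l).+1.
have xm : ~~ (p ^ k.+1 %| x m)%N.
  move: xk; rewrite padic_res_eq0 /dvdn -(padic_res_mod x k l.+1).
  by rewrite addnS.
have ym : ~~ (p ^ l.+1 %| y m)%N.
  move: yl; rewrite padic_res_eq0 /dvdn -(padic_res_mod y l k.+1).
  by rewrite addnS addnC.
have : (p ^ m.+1 %| x m * y m)%N.
  have : x m * y m = 0 by rewrite -padic_resM xy0 padic_res0.
  rewrite -[x m]natr_Zp -[y m]natr_Zp -natrM => /(congr1 (@nat_of_ord _)).
  by rewrite val_Zp_nat ?pexpn_gt1 // !natr_Zp => /eqP.
have pos (a q : nat) : ~~ (q %| a)%N -> (0 < a)%N.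
  by case: a => //; rewrite dvdn0.
have [xp yp] := (pos _ _ xm, pos _ _ ym).
rewrite pfactor_dvdn ?muln_gt0 ?xp // lognM //.
move: xm ym; rewrite !pfactor_dvdn // -!ltnNge !ltnS => xm ym.
by rewrite leqNgt ltnS (leq_trans (leq_add xm ym)) // /m leqW // leqnSn.
Qed.

HB.instance Definition _ :=
  GRing.ComUnitRing_isIntegral.Build Zp padic_int_idomain.

End PadicIntRing.

Notation padic p_pr := {fraction (padic_int p_pr)}.

Section Characters.
Context (p : nat) (p_pr : prime p) (R : realType).
Local Notation Qp := (padic p_pr).

Definition padic_integer : set Qp := range (@tofrac (padic_int p_pr)).

Definition expi2pi (t : R) : R[i] :=
  Complex (cos (2 * pi * t)) (sin (2 * pi * t)).

(* Every x in Q_p is congruent modulo Z_p to some a / p^k, which is unique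
   modulo Z, so the value does not depend on the choice of (a, k). *)
Definition padic_char (x : Qp) : R[i] :=
  let ak := xget (0 : int, 0%N)
    [set ak : int * nat | padic_integer (x - ak.1%:~R / p%:R ^+ ak.2)] in
  expi2pi (ak.1%:~R / p%:R ^+ ak.2).

(* psi_1, ..., psi_n are psi 0, ..., psi (n - 1). *)
Definition unip_char (n : nat) (psi : 'I_n -> int) (u : 'M[Qp]_n.+1) : R[i] :=
  padic_char (\sum_(j < n)
    (psi j)%:~R * u (widen_ord (leqnSn n) j) (lift ord0 j)).

End Characters.

Section Groups.
Context (p : nat) (p_pr : prime p) (n : nat).
Local Notation Qp := (padic p_pr).
Local Notation M := 'M[Qp]_n.+1.

Definition upper_unip : set M :=
  [set u | forall i j : 'I_n.+1, (j <= i)%N -> u i j = (i == j)%:R].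

Definition lower_unip : set M := [set u | upper_unip u^T].

Definition GL_Zp : set M :=
  [set x | exists2 g : 'M[padic_int p_pr]_n.+1,
     g \in unitmx & x = map_mx (@tofrac (padic_int p_pr)) g].

Definition unip_w (w : M) : set M :=
  upper_unip `&` [set invmx w *m v *m w | v in lower_unip].

Definition unip_bar_w (w : M) : set M :=
  upper_unip `&` [set invmx w *m v *m w | v in upper_unip].

Definition kl_set (N : M) : set M :=
  [set u *m N *m v | u in upper_unip & v in upper_unip] `&` GL_Zp.

(* The group H(Z_p) is H(Q_p) `&` GL_Zp, for H = U and H = U_w. *)
Definition kl_double_coset (w x : M) : set M :=
  [set g *m x *m h | g in upper_unip `&` GL_Zp & h in unip_w w `&` GL_Zp].

Definition kl_quotient (t w : M) : set (set M) :=
  kl_double_coset w @` kl_set (t *m w).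

(* The pair (u(x), u'(x)). *)
Definition bruhat_decomp (t w x : M) : M * M :=
  xget (1%:M, 1%:M)
    [set uv | [/\ upper_unip uv.1, unip_w w uv.2
                & x = uv.1 *m (t *m w) *m uv.2]].

End Groups.

Section KloostermanSum.
Context (p : nat) (p_pr : prime p) (R : realType) (n : nat).
Local Notation Qp := (padic p_pr).
Local Notation M := 'M[Qp]_n.+1.

(* The sum over a set is 0 by convention when infinitely many terms are
   nonzero, but kl_quotient t w is finite. Each term is computed at a chosen
   representative of the double coset, and does not depend on that choice:
   passing from x to g x h multiplies u(x) by g on the left and u'(x) by h on
   the right, and psi, psi' are trivial on U(Z_p). *)
Definition kloosterman (psi psi' : 'I_n -> int) (t w : M) : R[i] :=
  \sum_(X \in kl_quotient t w)
    (let uv := bruhat_decomp t w (xget 0 X) in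
     unip_char R psi uv.1 * unip_char R psi' uv.2).

Definition kl_well_defined (psi psi' : 'I_n -> int) (t w : M) : Prop :=
  forall v : M, unip_bar_w w v ->
    unip_char R psi ((t *m w) *m v *m invmx (t *m w)) = unip_char R psi' v.

End KloostermanSum.

Section SpecialElements.
Context (p : nat) (p_pr : prime p) (n : nat).
Local Notation Qp := (padic p_pr).

Definition w_star : 'M[Qp]_n.+1 :=
  \matrix_(i, j)
    if i == ord0 then (-1) ^+ n * (j == ord_max)%:R
    else if i == ord_max then (j == ord0)%:R
    else - (i == j)%:R.

(* diag(p^(-r_1), p^(r_1 - r_2), ..., p^(r_(n-1) - r_n), p^(r_n)) for
   C = (p^(r_1), ..., p^(r_n)). Entry i (from 0) has exponent r_i - r_(i+1),
   with r_0 = r_(n+1) = 0; r_k is r (k - 1), so that each sum below has at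
   most one term. *)
Definition C_star (r : 'I_n -> int) : 'M[Qp]_n.+1 :=
  diag_mx (\row_(i < n.+1)
    (p%:R ^ (\sum_(j < n | j.+1 == i) r j - \sum_(j < n | j == i :> nat) r j))).

End SpecialElements.

(* Main.v *)
(* An element of [C(N)] is [u N u'] with [u'] in the Heisenberg group [U_w], i.e.
   [u'] has first row [(1, a, c)] and last column [(c, b, 1)]. Modulo [U_w(Z_p)],
   [u'] is given by [A = p a], [B = p b], [C = p c] with entries in [F_p], and the
   cell is met by [GL(Z_p)] exactly when [C <> 0] and the support of [B] lies
   strictly to the left of the support of [A]. The matrix [u] is then explicit,
   and the sum becomes one over [F_p]: for fixed [C] and [B <> 0] with last nonzero
   entry [B_q], the coordinate [A_(q+1)] is free, so the sum over [A] vanishes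
   unless [q] is the last index, where [A = 0]; for [B = 0] the sum over [A]
   forces one value of [C]. *)

From HB Require Import structures.
Require Import Defs.
From mathcomp Require Import all_boot all_order all_algebra.
From mathcomp Require Import complex.
From mathcomp Require Import all_classical all_reals all_analysis.
From mathcomp Require Import zify ring.

Set Implicit Arguments.
Unset Strict Implicit.
Unset Printing Implicit Defensive.

Import Order.TTheory GRing.Theory Num.Theory.
Local Open Scope classical_set_scope.
Local Open Scope ring_scope.

(** * Residues and units of p-adic integers *)

(** Integrality of [x = u N u'] couples [u] to [u']. Write [f] for the middle part of the last
    column of [u] and [E] for its middle block. The middle rows of [x] say that [f A - E] and
    [C f - E B / p] are integral, and the triangular shape of [E] turns this into the order
    condition on the supports. Conversely, when [A B = 0] and [C] is a unit, solving these relations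
    exactly gives [f = B / (p C)] and [E = 1 + f A], and this [E] is upper unipotent precisely when
    [B_i A_j = 0] for all [j <= i]. Its superdiagonal puts the products [B_i A_(i+1)] into the
    phase, which is why the single coordinate [A_(q+1)] can kill a sum.

    The two powers of [p] arise as follows. For [B = 0] one value of [C] survives and contributes
    [p^(n-1)]. For [B] with nonzero last entry, completing to all [B] contributes [p^(n-1)] for one
    value of [C], and removing the [B] with last entry 0 costs [p^(n-2)] for each of the [p - 1]
    values of [C]; this leaves [p^(n-2)]. *)

Section PadicIntegers.
Context (p : nat) (p_pr : prime p).
Local Notation Zp := (padic_int p_pr).
Local Notation Qp := (padic p_pr).
Local Notation frac := (@tofrac Zp).

Lemma padic_res_nat (a k : nat) : (a%:R : Zp) k = a%:R.
Proof.
elim: a => [|a IHa]; first exact: padic_res0.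
by rewrite mulrSr padic_resD IHa padic_res1 -mulrSr.
Qed.

Lemma padic_res_int (a : int) k : (a%:~R : Zp) k = a%:~R.
Proof.
case: a => a; first exact: padic_res_nat.
by rewrite NegzE !mulrNz padic_resN -!pmulrn padic_res_nat.
Qed.

(** Dividing by [p] costs one digit of precision: level [k] of the quotient is level [k.+1] of [z]
    divided by [p]. *)
Lemma padic_dvdp (z : Zp) : z 0%N = 0 -> exists y : Zp, z = p%:R * y.
Proof.
move=> z0.
have p_gt0 := prime_gt0 p_pr.
have pz k : (p %| z k)%N.
  suff : (p ^ 1 %| z k)%N by rewrite {1}expn1.
  by rewrite /dvdn -[k]add0n padic_res_mod z0 mod0n.
have y_compat k : (nat_of_ord ((z k.+2 %/ p)%N%:R : 'Z_(p ^ k.+2)))%:R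
    = (z k.+1 %/ p)%N%:R :> 'Z_(p ^ k.+1).
  rewrite val_Zp_nat ?pexpn_gt1 // -[LHS]Zp_nat_mod ?pexpn_gt1 //.
  rewrite modn_dvdm ?dvdn_exp2l // -[RHS]Zp_nat_mod ?pexpn_gt1 //.
  congr (_%:R); apply/eqP; rewrite -(eqn_pmul2r p_gt0) !muln_modl.
  rewrite !divnK // -expnSr; apply/eqP.
  by have := padic_res_mod z k.+1 1; rewrite addn1.
exists (PadicInt p_pr y_compat); apply: padic_intP => k.
rewrite padic_resM padic_res_nat /= -natrM mulnC divnK //.
by rewrite padic_compat.
Qed.

(** Coprimality gives an inverse at every level, and uniqueness of inverses makes these
    compatible. *)
Lemma padic_nat_unit (a : nat) : coprime p a -> (a%:R : Zp) \is a GRing.unit.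
Proof.
move=> pa.
have aU k : (a%:R : 'Z_(p ^ k.+1)) \is a GRing.unit.
  by rewrite unitZpE ?pexpn_gt1 // coprimeXl.
have b_compat k : (nat_of_ord (a%:R^-1 : 'Z_(p ^ k.+2)))%:R
    = a%:R^-1 :> 'Z_(p ^ k.+1).
  apply: (mulrI (aU k)); rewrite divrr ?aU //.
  have <- : (nat_of_ord (a%:R : 'Z_(p ^ k.+2)))%:R = a%:R :> 'Z_(p ^ k.+1).
    by have := padic_compat (a%:R : Zp) k; rewrite !padic_res_nat.
  by rewrite -Zp_mod_natM ?pexpn_gt1 ?dvdn_exp2l // divrr ?aU.
apply/unitrPr; exists (PadicInt p_pr b_compat); apply: padic_intP => k.
by rewrite padic_resM padic_res_nat padic_res1 /= divrr ?aU.
Qed.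

(** Level 0 lives in ['Z_(p ^ 1)] while ['F_p] is ['Z_(pdiv p)]; the passage through [nat] bridges
    the two types, and the facts on [pdiv] below make it a ring morphism. *)
Definition res_p (z : Zp) : 'F_p := (nat_of_ord (z 0%N))%:R.

Lemma pdiv_dvd_expn1 : (pdiv p %| p ^ 1)%N.
Proof. by rewrite expn1 pdiv_dvd. Qed.

Lemma pdiv_pr_gt1 : (1 < pdiv p)%N.
Proof. by rewrite pdiv_id // prime_gt1. Qed.

Lemma res_p_is_zmod_morphism : zmod_morphism res_p.
Proof.
have resD x y : res_p (x + y) = res_p x + res_p y.
  rewrite /res_p padic_resD Zp_mod_natD ?pexpn_gt1 //; last exact: pdiv_dvd_expn1.
  exact: pdiv_pr_gt1.
by move=> x y; apply: (addIr (res_p y)); rewrite -resD !subrK.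
Qed.

Lemma res_p_is_monoid_morphism : monoid_morphism res_p.
Proof.
split=> [|x y].
  change (res_p 1%:R = 1).
  by rewrite /res_p padic_res_nat val_Zp_nat ?pexpn_gt1 // modn_small // pexpn_gt1.
rewrite /res_p padic_resM Zp_mod_natM ?pexpn_gt1 //; last exact: pdiv_dvd_expn1.
exact: pdiv_pr_gt1.
Qed.

HB.instance Definition _ :=
  GRing.isZmodMorphism.Build Zp 'F_p res_p res_p_is_zmod_morphism.
HB.instance Definition _ :=
  GRing.isMonoidMorphism.Build Zp 'F_p res_p res_p_is_monoid_morphism.

Lemma res_p_eq0 (z : Zp) : (res_p z == 0) = (p %| z 0%N)%N.
Proof.
have := @dvdn_pcharf 'F_p p (pchar_Fp p_pr) (z 0%N).
by rewrite /res_p => ->.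
Qed.

Lemma res_p_eq0P (z : Zp) : res_p z = 0 -> exists y : Zp, z = p%:R * y.
Proof.
move/eqP; rewrite res_p_eq0 => pz; apply: padic_dvdp.
by apply/eqP; rewrite padic_res_eq0 {1}expn1.
Qed.

Lemma res_p_lift (a : 'F_p) : res_p (nat_of_ord a)%:R = a.
Proof. by rewrite rmorph_nat natr_Zp. Qed.

Lemma lift_Fp_unit (a : 'F_p) : a != 0 -> ((nat_of_ord a)%:R : Zp) \is a GRing.unit.
Proof.
move=> a0; apply: padic_nat_unit; rewrite prime_coprime //.
by rewrite (dvdn_pcharf (pchar_Fp p_pr)) natr_Zp.
Qed.

Lemma frac_p_neq0 : p%:R != 0 :> Qp.
Proof.
have -> : p%:R = frac p%:R by rewrite rmorph_nat.
(* Level 1, that is modulo [p^2], since [p] is 0 at level 0. *)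
rewrite tofrac_eq0; apply/eqP => /(congr1 (fun z : Zp => z 1%N)).
rewrite padic_res_nat padic_res0 => /eqP.
rewrite -val_eqE /= val_Zp_nat ?pexpn_gt1 // modn_small; last first.
  by rewrite -{1}[p]expn1 ltn_exp2l // prime_gt1.
by rewrite eqn0Ngt prime_gt0.
Qed.

Lemma padic_integer_subring : subring_closed (fun x : Qp => `[< padic_integer x >]).
Proof.
split=> [|x y|x y]; rewrite ?unfold_in.
- by apply/asboolP; exists 1; rewrite ?rmorph1.
- move=> /asboolP[a _ <-] /asboolP[b _ <-].
  by apply/asboolP; exists (a - b); rewrite ?rmorphB.
- move=> /asboolP[a _ <-] /asboolP[b _ <-].
  by apply/asboolP; exists (a * b); rewrite ?rmorphM.
Qed.

End PadicIntegers.

(** Boolean form of [padic_integer], registered as a subring so that the [rpred] lemmas and [mxOver]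
    apply to integrality. *)
Definition Zp_int p (p_pr : prime p) : {pred padic p_pr} :=
  fun x => `[< padic_integer x >].
Arguments Zp_int {p p_pr}.

HB.instance Definition _ p (p_pr : prime p) :=
  GRing.isSubringClosed.Build (padic p_pr) (@Zp_int p p_pr)
    (@padic_integer_subring p p_pr).

Section Integrality.
Context (p : nat) (p_pr : prime p).
Local Notation Zp := (padic_int p_pr).
Local Notation Qp := (padic p_pr).
Local Notation frac := (@tofrac Zp).

Lemma Zp_intP (x : Qp) : reflect (exists z : Zp, x = frac z) (x \in Zp_int).
Proof.
apply: (iffP (asboolP _)) => [[z _ <-]|[z ->]]; first by exists z.
by exists z.
Qed.

Lemma Zp_int_frac (z : Zp) : frac z \in Zp_int.
Proof. by apply/Zp_intP; exists z. Qed.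

Lemma lift_Fp_neq0 (a : 'F_p) : a != 0 -> (nat_of_ord a)%:R != 0 :> Qp.
Proof.
move=> a0; rewrite -(rmorph_nat frac) tofrac_eq0.
by apply: contraTneq (lift_Fp_unit p_pr a0) => ->; rewrite unitr0.
Qed.

Lemma lift_Fp_inv_int (a : 'F_p) : a != 0 -> (nat_of_ord a)%:R^-1 \in @Zp_int p p_pr.
Proof.
move=> a0; apply/Zp_intP; exists ((nat_of_ord a)%:R^-1).
apply: (@mulfI _ (nat_of_ord a)%:R).
  exact: lift_Fp_neq0.
rewrite divff ?lift_Fp_neq0 // -[X in _ = X * _](rmorph_nat frac) -rmorphM /=.
by rewrite divrr ?lift_Fp_unit // rmorph1.
Qed.

Lemma Zp_int_divp (z : Zp) : (frac z / p%:R \in Zp_int) = (res_p z == 0).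
Proof.
have p0 := frac_p_neq0 p_pr.
apply/Zp_intP/eqP => [[y /(congr1 ( *%R^~ p%:R))]|/res_p_eq0P[y ->]].
  rewrite divfK // -[p%:R](rmorph_nat frac) -rmorphM /=.
  move=> /eqP; rewrite tofrac_eq => /eqP ->.
  by rewrite rmorphM /= rmorph_nat pchar_Fp_0 // mulr0.
by exists y; rewrite rmorphM /= rmorph_nat mulrAC divff // mul1r.
Qed.

(** With [lift_Fp_exists]: the fractions [a / p], [0 <= a < p], represent each class of
    [p^-1 Z_p / Z_p] once. They serve as coordinates on the double cosets. *)
Lemma lift_Fp_inj (a b : 'F_p) :
  ((nat_of_ord a)%:R / p%:R - (nat_of_ord b)%:R / p%:R \in @Zp_int p p_pr) = (a == b).
Proof.
rewrite -mulrBl -(rmorph_nat frac a) -(rmorph_nat frac b) -rmorphB /=.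
rewrite Zp_int_divp rmorphB /=.
by rewrite !res_p_lift subr_eq0.
Qed.

Lemma lift_Fp_exists (x : Qp) : p%:R * x \in Zp_int ->
  exists a : 'F_p, x - (nat_of_ord a)%:R / p%:R \in Zp_int.
Proof.
have p0 := frac_p_neq0 p_pr.
move=> /Zp_intP[z xz]; exists (res_p z).
have -> : x = frac z / p%:R by rewrite -xz mulrAC divff // mul1r.
by rewrite -mulrBl -(rmorph_nat frac (res_p z)) -rmorphB /= Zp_int_divp rmorphB /= res_p_lift subrr.
Qed.

End Integrality.

(** * The additive character *)

Lemma frac_subr (F : fieldType) (x a b c d : F) : c != 0 -> d != 0 ->
  (a * d - b * c) / (c * d) = (x - b / d) - (x - a / c).
Proof. by move=> c0 d0; field; rewrite c0 d0. Qed.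

Section Character.
Context (p : nat) (p_pr : prime p) (R : realType).
Local Notation Zp := (padic_int p_pr).
Local Notation Qp := (padic p_pr).
Local Notation frac := (@tofrac Zp).

Lemma expi2piD (s t : R) : expi2pi (s + t) = expi2pi s * expi2pi t.
Proof.
rewrite /expi2pi mulrDr cosD sinD; apply/eqP; rewrite eq_complex /=.
by rewrite !eqxx /= addrC.
Qed.

Lemma expi2pi0 : expi2pi (0 : R) = 1.
Proof. by rewrite /expi2pi mulr0 cos0 sin0. Qed.

Lemma expi2pi_nat (n : nat) : expi2pi (n%:R : R) = 1.
Proof.
elim: n => [|n IHn]; first exact: expi2pi0.
rewrite -natr1 expi2piD IHn mul1r /expi2pi mulr1.
by rewrite mulr_natl cos2pi sin2pi.
Qed.

Lemma expi2pi_int (m : int) : expi2pi (m%:~R : R) = 1.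
Proof.
case: m => m; first exact: expi2pi_nat.
have := expi2piD (Negz m)%:~R (m.+1%:R : R).
by rewrite NegzE mulrNz -pmulrn addNr expi2pi0 expi2pi_nat mulr1.
Qed.

(** The intersection of [Z_p] and [Z[1/p]] is [Z]. Hence two fractions congruent to the same [x]
    modulo [Z_p] differ by an integer, on which [expi2pi] is 1; this yields [padic_charE]. *)
Lemma padic_integer_int_div (a : int) (k : nat) :
  (a%:~R / p%:R ^+ k : Qp) \in Zp_int -> exists m : int, a = m * (p ^ k)%:Z.
Proof.
have p0 := frac_p_neq0 p_pr.
move=> /Zp_intP[z az].
have az' : a%:~R = z * (p ^ k)%:R :> Zp.
  apply/eqP; rewrite -tofrac_eq rmorphM /= -az rmorph_int natrX rmorphXn /=.
  by rewrite rmorph_nat divfK ?expf_neq0.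
case: k az az' => [|k] az az'; first by exists a; rewrite mulr1.
have /eqP: a%:~R = 0 :> 'Z_(p ^ k.+1).
  rewrite -(padic_res_int p_pr) az' padic_resM padic_res_nat.
  by rewrite -Zp_nat_mod ?pexpn_gt1 // modnn mulr0.
have dvd (b : nat) : (b%:R == 0 :> 'Z_(p ^ k.+1)) -> (p ^ k.+1 %| b)%N.
  by rewrite -val_eqE /= val_Zp_nat ?pexpn_gt1.
case: a az az' => b az az'.
  by move=> /dvd/dvdnP[c ->]; exists c%:Z; rewrite PoszM.
rewrite NegzE mulrNz oppr_eq0 -pmulrn => /dvd/dvdnP[c ->].
by exists (- c%:Z); rewrite PoszM mulNr.
Qed.

Lemma padic_charE (x : Qp) (a : int) (k : nat) :
  x - a%:~R / p%:R ^+ k \in Zp_int -> padic_char R x = expi2pi (a%:~R / p%:R ^+ k).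
Proof.
have p0 := frac_p_neq0 p_pr.
have p0R : p%:R != 0 :> R by rewrite pnatr_eq0 -lt0n prime_gt0.
move=> xa; rewrite /padic_char; case: xgetP => [[b l] _ /= /asboolP xb|/(_ (a, k))]; last first.
  by move: xa => /asboolP.
have : ((a * p%:Z ^+ l - b * p%:Z ^+ k)%:~R / p%:R ^+ (k + l) : Qp) \in Zp_int.
  have -> : (a * p%:Z ^+ l - b * p%:Z ^+ k)%:~R / p%:R ^+ (k + l)
      = (x - b%:~R / p%:R ^+ l) - (x - a%:~R / p%:R ^+ k).
    rewrite rmorphB !rmorphM /= !rmorphXn /= exprD -!pmulrn.
    by rewrite (frac_subr x) // expf_neq0.
  exact: rpredB.
move=> /padic_integer_int_div[m abm].
suff -> : a%:~R / p%:R ^+ k = b%:~R / p%:R ^+ l + m%:~R :> R.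
  by rewrite expi2piD expi2pi_int mulr1.
have /(congr1 (fun z : int => z%:~R : R)) := abm.
rewrite rmorphB !rmorphM /= !rmorphXn /= -!pmulrn exprD => abm'.
apply: (mulIf (expf_neq0 k p0R)); apply: (mulIf (expf_neq0 l p0R)).
rewrite divfK ?expf_neq0 //; move/eqP: abm'; rewrite subr_eq => /eqP ->.
by field; rewrite expf_neq0.
Qed.

(** Both arguments are congruent to the same fractions, so [xget] is applied to the same set. *)
Lemma padic_charD_int (x z : Qp) : z \in Zp_int -> padic_char R (x + z) = padic_char R x.
Proof.
move=> zZ; rewrite /padic_char; set P := [set ak | _]; set Q := [set ak | _].
suff -> : P = Q by [].
apply/seteqP; split=> ak; rewrite /P /Q /= => /asboolP xa; apply/asboolP.
  by have := rpredB (xa : _ \in Zp_int) zZ; rewrite addrAC addrK.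
by have := rpredD (xa : _ \in Zp_int) zZ; rewrite addrAC.
Qed.

Definition fp_char (a : 'F_p) : R[i] := expi2pi ((nat_of_ord a)%:R / p%:R).

Lemma padic_char_divp (z : Zp) : padic_char R (frac z / p%:R) = fp_char (res_p z).
Proof.
have := @padic_charE (frac z / p%:R) (nat_of_ord (res_p z)) 1; rewrite !expr1.
apply; rewrite -mulrBl -pmulrn -(rmorph_nat frac (res_p z)) -rmorphB /=.
by rewrite Zp_int_divp rmorphB /= res_p_lift subrr.
Qed.

Lemma fp_char_nat (n : nat) : fp_char n%:R = expi2pi (n%:R / p%:R).
Proof.
have p0R : p%:R != 0 :> R by rewrite pnatr_eq0 -lt0n prime_gt0.
rewrite /fp_char val_Fp_nat // {2}(divn_eq n p) natrD natrM mulrDl mulfK //.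
by rewrite expi2piD expi2pi_nat mul1r.
Qed.

Lemma fp_charD (a b : 'F_p) : fp_char (a + b) = fp_char a * fp_char b.
Proof.
by rewrite -expi2piD -mulrDl -natrD -fp_char_nat natrD !natr_Zp.
Qed.

Lemma fp_char0 : fp_char 0 = 1.
Proof. by rewrite /fp_char mul0r expi2pi0. Qed.

Lemma fp_char1_neq1 : fp_char 1 != 1.
Proof.
change (fp_char 1%:R != 1); rewrite fp_char_nat mul1r; apply/eqP.
move=> /(congr1 (@complex.Re R)) /= cos1.
have p2 : 2 <= p%:R :> R by rewrite ler_nat prime_gt1.
have p_gt0 : 0 < p%:R :> R by apply: lt_le_trans p2.
have pi0 : 0 < pi :> R := pi_gt0 R.
(* Since [p >= 2], the angle lies in the interval where the cosine is injective. *)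
have h1 : (2 * pi / p%:R : R) \in `[0, pi].
  rewrite in_itv /= ler_pdivrMr // [2 * _]mulrC ler_pM2l // p2 andbT.
  by rewrite divr_ge0 ?mulr_ge0 // ltW.
have h0 : (0 : R) \in `[0, pi] by rewrite in_itv /= lexx (ltW pi0).
have /eqP := cos_inj h1 h0 (etrans cos1 (esym (cos0 R))).
by rewrite !mulf_eq0 invr_eq0 !gt_eqF.
Qed.

End Character.

(** * The sum over the residue field *)

Section FiniteKloosterman.
Context (F : finFieldType) (K : idomainType) (e : F -> K).
Hypotheses (eD : forall a b, e (a + b) = e a * e b) (e0 : e 0 = 1) (e1 : e 1 != 1).
Context (k : nat).
Local Notation V := {ffun 'I_k.+1 -> F}.
Local Notation q := (#|F|%:R : K).

(** Reindexing by [h] gives [S = z S] for the sum [S], with [z <> 1] in a domain. *)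
Lemma sum_shift_eq0 (T : finType) (P : pred T) (h : T -> T) (f : T -> K) (z : K) :
  injective h -> (forall x, P (h x) = P x) ->
  (forall x, P x -> f (h x) = z * f x) -> z != 1 -> \sum_(x | P x) f x = 0.
Proof.
move=> h_inj hP hf z1; apply/eqP; set S := \sum_(x | P x) f x.
have : S = z * S.
  rewrite {1}/S (reindex_inj h_inj) /S mulr_sumr.
  by apply: eq_big => [x|x Px]; rewrite ?hP // hf // -hP.
move/eqP; rewrite -subr_eq0 -{1}[S]mul1r -mulrBl mulf_eq0 subr_eq0 eq_sym.
by rewrite (negbTE z1).
Qed.

Definition shift_at (j : 'I_k.+1) (x : F) (A : V) : V :=
  [ffun i => A i + x * (i == j)%:R].

Lemma shift_at_inj j x : injective (shift_at j x).
Proof.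
move=> A A' /ffunP AA'; apply/ffunP => i.
by have := AA' i; rewrite !ffunE => /addIr.
Qed.

(** The rank one matrix [(B_i A_j)] is strictly upper triangular. This form is the one that both the
    unipotence of [cell_u] and the vanishing of [A B] use. *)
Definition strictly_below (B A : V) : bool :=
  [forall i : 'I_k.+1, forall j : 'I_k.+1, (j <= i)%N ==> ((A j == 0) || (B i == 0))].

Lemma strictly_belowP (B A : V) :
  reflect (forall i j : 'I_k.+1, (j <= i)%N -> (A j == 0) || (B i == 0))
    (strictly_below B A).
Proof.
apply: (iffP forallP) => [BA i j ji|BA i].
  by have /forallP/(_ j)/implyP/(_ ji) := BA i.
by apply/forallP => j; apply/implyP/BA.
Qed.

Context (al al' be be' : F) (c : 'I_k -> F).
Hypotheses (al0 : al != 0) (al'0 : al' != 0) (be0 : be != 0) (be'0 : be' != 0).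
Hypothesis c0 : forall i, c i != 0.

(** The three terms divided by [C] come from the superdiagonal of [u]: first row, middle block, last
    column. The last two come from [u']. The coefficient [al] also carries the sign of the first row
    of [u]. *)
Definition kl_phase (C : F) (B A : V) : F :=
  al * A ord0 / C
  + \sum_(i < k) c i * B (widen_ord (leqnSn k) i) * A (lift ord0 i) / C
  + be * B ord_max / C + al' * A ord0 + be' * B ord_max.

Lemma sum_linear_eq0 (j : 'I_k.+1) (x : F) : x != 0 -> \sum_(A : V) e (x * A j) = 0.
Proof.
move=> x0; apply: (sum_shift_eq0 (@shift_at_inj j x^-1)) e1 => // A _.
by rewrite !ffunE eqxx mulr1 mulrDr divff // eD mulrC.
Qed.

Lemma sum_linear (j : 'I_k.+1) (x : F) :
  \sum_(A : V) e (x * A j) = (x == 0)%:R * q ^+ k.+1.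
Proof.
have [->|x0] := eqVneq x 0; last by rewrite sum_linear_eq0 // mul0r.
rewrite mul1r; under eq_bigr do rewrite mul0r e0.
by rewrite sumr_const card_ffun card_ord natrX.
Qed.

Lemma card_ffun_last0 : #|[pred B : V | B ord_max == 0]| = (#|F| ^ k)%N.
Proof.
have -> : #|[pred B : V | B ord_max == 0]| = #|pffun_on 0 (predC1 (ord_max : 'I_k.+1)) (@predT F)|.
  apply: eq_card => B; rewrite inE; apply/eqP/pffun_onP => [B0|[/fintype.subsetP sB _]].
    split=> // ; apply/fintype.subsetP => i; rewrite !inE; apply: contraNneq => ->.
    by rewrite B0.
  by apply: contraTeq isT => Bn0; have := sB ord_max; rewrite !inE Bn0 eqxx => /(_ isT).
by rewrite card_pffun_on cardC1 card_ord.
Qed.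

Lemma inner_sum (C : F) (B : V) : C != 0 ->
  \sum_(A | strictly_below B A) e (kl_phase C B A) =
    if B == 0 then (al / C + al' == 0)%:R * q ^+ k.+1
    else (B ord_max != 0)%:R * e ((be / C + be') * B ord_max).
Proof.
move=> C0; have [->|Bn0] := eqVneq B 0.
  rewrite -(sum_linear ord0); apply: eq_big => [A|A _].
    by apply/strictly_belowP => i j _; rewrite ffunE eqxx orbT.
  congr e; rewrite /kl_phase big1 => [|i _]; last by rewrite ffunE mulr0 !mul0r.
  by rewrite ffunE !mulr0 mul0r !addr0 mulrDl mulrAC.
have [i0 Bi0] : exists i, B i != 0.
  apply/existsP; apply: contraNT Bn0 => /existsPn B0.
  by apply/eqP/ffunP => i; rewrite ffunE; apply/eqP; have := B0 i; rewrite negbK.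
pose t := [arg max_(i > i0 | B i != 0) (i : nat)].
have [Bt tmax] : B t != 0 /\ forall i, B i != 0 -> (i <= t)%N.
  by rewrite /t; case: arg_maxnP.
have [tk|tk] := eqVneq t ord_max.
  have Bk : B ord_max != 0 by rewrite -tk.
  rewrite Bk mul1r (big_pred1 (0 : V)) => [|A].
    congr e; rewrite /kl_phase big1 => [|i _]; last by rewrite ffunE mulr0 mul0r.
    by rewrite ffunE !mulr0 mul0r !add0r addr0 mulrDl mulrAC.
  apply/strictly_belowP/eqP => [BA|-> i j _]; last by rewrite ffunE eqxx.
  apply/ffunP => j; rewrite ffunE; apply/eqP.
  by have := BA ord_max j (leq_ord j); rewrite (negbTE Bk) orbF.
have -> : B ord_max = 0.
  apply/eqP; apply: contraNT tk => /tmax tk.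
  by rewrite -val_eqE eqn_leq /= leq_ord.
rewrite eqxx mul0r.
have ltk : (t < k)%N.
  by rewrite ltn_neqAle -ltnS ltn_ord andbT; apply: contraNneq tk => tk; apply/eqP/val_inj.
pose i := Ordinal ltk.
have ti : widen_ord (leqnSn k) i = t by apply: val_inj.
have x0 : c i * B t / C != 0 by rewrite !mulf_neq0 ?invr_eq0.
(* Here [t < k] is the last index with [B t != 0]. The coordinate of [A] at [t + 1] lies beyond the
   support of [B], so shifting it preserves [strictly_below]; it meets only one term of the phase,
   and the increment is chosen so that this term grows by 1. *)
apply: (sum_shift_eq0 (@shift_at_inj (lift ord0 i) (c i * B t / C)^-1)) e1 => [A|A BA].
  apply: eq_forallb => i'; apply: eq_forallb => j; rewrite ffunE.
  have [ij|//] := leqP j i'; have [jt|] := eqVneq j (lift ord0 i); last by rewrite mulr0 addr0.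
  suff -> : B i' == 0 by rewrite !orbT.
  apply: contraTT ij => /tmax i't; rewrite jt -ltnNge /= /bump /=.
  by rewrite add1n ltnS.
rewrite -eD; congr e; rewrite /kl_phase !ffunE /= mulr0 addr0.
rewrite [\sum_(i0 < k) _ in LHS](_ : _ =
    \sum_(i < k) c i * B (widen_ord (leqnSn k) i) * A (lift ord0 i) / C + 1).
  by ring.
have -> : 1 = \sum_(i' < k) (c i' * B (widen_ord (leqnSn k) i') / C) * (c i * B t / C)^-1 * (i' == i)%:R.
  rewrite (bigD1 i) //= big1 => [|i' /negbTE->]; last by rewrite mulr0.
  by rewrite eqxx mulr1 addr0 ti divff.
rewrite -big_split /=; apply: eq_bigr => i' _; rewrite ffunE (inj_eq lift_inj).
ring.
Qed.

Lemma sum_indicator (x y : F) : x != 0 -> y != 0 ->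
  \sum_(C : F | C != 0) (x / C + y == 0)%:R = 1 :> K.
Proof.
move=> x0 y0; rewrite (bigD1 (- x / y)) /=; last by rewrite mulf_neq0 ?invr_eq0 ?oppr_eq0.
rewrite invfM invrN mulrA mulrN divff // mulNr mul1r invrK addNr eqxx big1 ?addr0 // => C.
move=> /andP[C0 Cxy]; case: eqP => // /eqP; rewrite addr_eq0 => /eqP xC.
case/eqP: Cxy; have -> : x = - y * C by rewrite -xC divfK.
by rewrite [- y * C]mulNr opprK mulrAC divff // mul1r.
Qed.

Lemma finite_kloosterman :
  \sum_(t : F * (V * V) | (t.1 != 0) && strictly_below t.2.1 t.2.2)
     e (kl_phase t.1 t.2.1 t.2.2) = q ^+ k.+1 + q ^+ k.
Proof.
transitivity (\sum_(C | C != 0) \sum_(B : V) \sum_(A | strictly_below B A) e (kl_phase C B A)).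
  under [RHS]eq_bigr do rewrite pair_big_dep.
  by rewrite pair_big_dep.
have sumB C : C != 0 -> \sum_(B : V) \sum_(A | strictly_below B A) e (kl_phase C B A)
   = (al / C + al' == 0)%:R * q ^+ k.+1 + ((be / C + be' == 0)%:R * q ^+ k.+1 - q ^+ k).
  move=> C0; under eq_bigr do rewrite inner_sum //.
  rewrite (bigD1 (0 : V)) //= eqxx; congr (_ + _).
  (* The index [B = 0] can be put back because its last entry vanishes. The indicator is then
     removed by completing the sum and subtracting the [B] with last entry 0, whose terms are all
     1. *)
  transitivity (\sum_(B : V) (B ord_max != 0)%:R * e ((be / C + be') * B ord_max)).
    rewrite [RHS](bigD1 (0 : V)) //= ffunE eqxx mul0r add0r.
    by apply: eq_bigr => B /negbTE->.
  apply/eqP; rewrite eq_sym subr_eq -(sum_linear ord_max); apply/eqP.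
  rewrite [LHS](bigID [pred B : V | B ord_max == 0]) /= addrC; congr (_ + _).
    rewrite big_mkcond /=; apply: eq_bigr => B _.
    by case: eqP => _; rewrite ?mul0r ?mul1r.
  rewrite (eq_bigr (fun=> 1)) => [|B /eqP->]; last by rewrite mulr0 e0.
  by rewrite sumr_const card_ffun_last0 natrX.
rewrite (eq_bigr _ sumB) !big_split /= -!mulr_suml !sum_indicator //.
rewrite sumrN sumr_const cardC1 !mul1r; congr (_ + _).
have F0 : (0 < #|F|)%N by apply/card_gt0P; exists 0.
rewrite -subn1 mulrnBr // mulr1n -[q ^+ k *+ _]mulr_natl exprS; ring.
Qed.

End FiniteKloosterman.

(** * Block matrices and unipotent groups *)

Section Blocks.
Context (R : Type) (m : nat).

(** Blocks of sizes 1, m, 1, the shape preserved by [w_star]. The size [1 + (m + 1)] is convertible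
    to [n.+1] for [n = m + 1]. *)
Definition mx3 (a : 'M[R]_1) (b : 'rV[R]_m) (c : 'M[R]_1)
    (d : 'cV[R]_m) (E : 'M[R]_m) (f : 'cV[R]_m)
    (g : 'M[R]_1) (h : 'rV[R]_m) (i : 'M[R]_1) : 'M[R]_(1 + (m + 1)) :=
  block_mx a (row_mx b c) (col_mx d g) (block_mx E f h i).

Lemma mx3_surj (X : 'M[R]_(1 + (m + 1))) :
  exists a b c d E f g h i, X = mx3 a b c d E f g h i.
Proof.
do 9!eexists; rewrite -[LHS]submxK /mx3; congr block_mx.
- by rewrite -[LHS]hsubmxK; reflexivity.
- by rewrite -[LHS]vsubmxK; reflexivity.
- by rewrite -[LHS]submxK; reflexivity.
Qed.

Lemma mx3_inj a b c d E f g h i a' b' c' d' E' f' g' h' i' :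
  mx3 a b c d E f g h i = mx3 a' b' c' d' E' f' g' h' i' ->
  [/\ [/\ a = a', b = b' & c = c'], [/\ d = d', E = E' & f = f']
    & [/\ g = g', h = h' & i = i']].
Proof.
by case/eq_block_mx => -> /eq_row_mx[-> ->] /eq_col_mx[-> ->] /eq_block_mx[-> -> -> ->].
Qed.

End Blocks.

Section BlockEntries.
Context (R : Type) (m : nat).

Definition fst3 : 'I_(1 + (m + 1)) := lshift (m + 1) ord0.
Definition mid3 (j : 'I_m) : 'I_(1 + (m + 1)) := rshift 1 (lshift 1 j).
Definition lst3 : 'I_(1 + (m + 1)) := rshift 1 (rshift m ord0).

Variant ord3_spec : 'I_(1 + (m + 1)) -> Type :=
  | Ord3Fst : ord3_spec fst3
  | Ord3Mid j : ord3_spec (mid3 j)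
  | Ord3Lst : ord3_spec lst3.

Lemma ord3P i : ord3_spec i.
Proof.
case: (split_ordP i) => i' ->; first by rewrite (ord1 i'); apply: Ord3Fst.
case: (split_ordP i') => i'' ->; first exact: Ord3Mid.
by rewrite (ord1 i''); apply: Ord3Lst.
Qed.

Lemma ord3_eqE :
  ((forall j, (fst3 == mid3 j) = false) * ((fst3 == lst3) = false)
  * (forall j, (mid3 j == fst3) = false) * (forall j, (mid3 j == lst3) = false)
  * (forall i j, (mid3 i == mid3 j) = (i == j))
  * ((lst3 == fst3) = false) * (forall j, (lst3 == mid3 j) = false))%type.
Proof.
rewrite /fst3 /mid3 /lst3.
by repeat split; move=> *; rewrite ?eq_lrshift ?eq_rlshift
  ?(inj_eq (@rshift_inj _ _)) ?eq_lrshift ?eq_rlshift ?(inj_eq (@lshift_inj _ _)).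
Qed.

Lemma ord3_leE :
  ((forall j, (mid3 j <= fst3)%N = false) * ((lst3 <= fst3)%N = false)
  * (forall i j, (mid3 i <= mid3 j)%N = (i <= j)%N)
  * (forall j, (mid3 j <= lst3)%N = true)
  * (forall j, (lst3 <= mid3 j)%N = false))%type.
Proof.
repeat split; move=> *; rewrite //= ?addn0 ?leq_add2l //.
  by rewrite ltnW.
by apply/negbTE; rewrite -ltnNge.
Qed.

Context (a : 'M[R]_1) (b : 'rV[R]_m) (c : 'M[R]_1)
    (d : 'cV[R]_m) (E : 'M[R]_m) (f : 'cV[R]_m)
    (g : 'M[R]_1) (h : 'rV[R]_m) (i : 'M[R]_1).

Lemma mx3E :
  ((mx3 a b c d E f g h i fst3 fst3 = a ord0 ord0)
  * (forall s, mx3 a b c d E f g h i fst3 (mid3 s) = b ord0 s)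
  * (mx3 a b c d E f g h i fst3 lst3 = c ord0 ord0)
  * (forall r, mx3 a b c d E f g h i (mid3 r) fst3 = d r ord0)
  * (forall r s, mx3 a b c d E f g h i (mid3 r) (mid3 s) = E r s)
  * (forall r, mx3 a b c d E f g h i (mid3 r) lst3 = f r ord0)
  * (mx3 a b c d E f g h i lst3 fst3 = g ord0 ord0)
  * (forall s, mx3 a b c d E f g h i lst3 (mid3 s) = h ord0 s)
  * (mx3 a b c d E f g h i lst3 lst3 = i ord0 ord0))%type.
Proof.
rewrite /mx3 /fst3 /lst3 /mid3.
repeat split; move=> *;
by rewrite ?(block_mxEul, block_mxEur, block_mxEdl, block_mxEdr,
  row_mxEl, row_mxEr, col_mxEu, col_mxEd).
Qed.

End BlockEntries.
Arguments fst3 {m}.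
Arguments lst3 {m}.

Lemma mul_mx3 (R : pzRingType) m a b c d E f g h i a' b' c' d' E' f' g' h' i' :
  @mx3 R m a b c d E f g h i *m mx3 a' b' c' d' E' f' g' h' i' =
  mx3 (a *m a' + (b *m d' + c *m g')) (a *m b' + (b *m E' + c *m h'))
      (a *m c' + (b *m f' + c *m i'))
      (d *m a' + (E *m d' + f *m g')) (d *m b' + (E *m E' + f *m h'))
      (d *m c' + (E *m f' + f *m i'))
      (g *m a' + (h *m d' + i *m g')) (g *m b' + (h *m E' + i *m h'))
      (g *m c' + (h *m f' + i *m i')).
Proof.
rewrite /mx3 mulmx_block mul_row_col mul_row_block mul_block_col mul_col_row.
by rewrite mul_mx_row mul_col_mx mulmx_block add_row_mx add_col_mx add_block_mx.
Qed.

Lemma mx3_1 (R : pzRingType) m : 1%:M = @mx3 R m 1%:M 0 0 0 1%:M 0 0 0 1%:M.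
Proof. by rewrite /mx3 row_mx0 col_mx0 -!scalar_mx_block. Qed.

Lemma diag_mx3 (R : pzRingType) m (d : 'rV[R]_(1 + (m + 1))) (x z : R) :
  d 0 (lshift _ 0) = x -> (forall j, d 0 (rshift 1 (lshift 1 j)) = 1) ->
  d 0 (rshift 1 (rshift m 0)) = z ->
  diag_mx d = mx3 x%:M 0 0 0 1%:M 0 0 0 z%:M.
Proof.
move=> d0 d1 d2; rewrite -[d]hsubmxK -[rsubmx d]hsubmxK diag_mx_row diag_mx_row /mx3.
rewrite row_mx0 col_mx0; congr (block_mx _ _ _ (block_mx _ _ _ _)).
- by apply/matrixP => i j; rewrite !mxE (ord1 i) (ord1 j) !eqxx d0.
- by apply/matrixP => i j; rewrite !mxE d1.
- by apply/matrixP => i j; rewrite !mxE (ord1 i) (ord1 j) !eqxx d2.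
Qed.

Section UpperUnip.
Context (p : nat) (p_pr : prime p).
Local Notation Qp := (padic p_pr).

Lemma upper_unip_diag n (u : 'M[Qp]_n.+1) i : upper_unip u -> u i i = 1.
Proof. by move=> uU; rewrite uU // eqxx. Qed.

Lemma upper_unip_lt n (u : 'M[Qp]_n.+1) (i j : 'I_n.+1) :
  upper_unip u -> (j < i)%N -> u i j = 0.
Proof.
move=> uU ji; rewrite uU; last exact: ltnW.
by rewrite -val_eqE /= eqn_leq leqNgt ji.
Qed.

Lemma upper_unip1 n : upper_unip (1%:M : 'M[Qp]_n.+1).
Proof. by move=> i j _; rewrite mxE. Qed.

Lemma upper_unipM n (u v : 'M[Qp]_n.+1) :
  upper_unip u -> upper_unip v -> upper_unip (u *m v).
Proof.
move=> uU vU i j ji; rewrite mxE (bigD1 i) //= upper_unip_diag // mul1r.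
rewrite (vU i j ji) big1 ?addr0 // => l li.
have [il|il] := ltnP i l; last first.
  by rewrite (upper_unip_lt uU) ?mul0r // ltn_neqAle val_eqE li.
by rewrite (upper_unip_lt vU) ?mulr0 // (leq_ltn_trans ji).
Qed.

(** Only the indices [i] and [i + 1] contribute to the entry. This additivity is behind the
    invariance of [unip_char] under integral unipotents on either side. *)
Lemma upper_unipM_super n (u v : 'M[Qp]_n.+1) (i j : 'I_n.+1) : j = i.+1 :> nat ->
  upper_unip u -> upper_unip v -> (u *m v) i j = u i j + v i j.
Proof.
move=> ij uU vU; rewrite mxE (bigD1 i) //= upper_unip_diag // mul1r addrC; congr (_ + _).
rewrite (bigD1 j) /=; last by rewrite -val_eqE /= ij gtn_eqF.
rewrite upper_unip_diag // mulr1 big1 ?addr0 // => l /andP[li lj].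
have [il|il] := ltnP i l; last first.
  by rewrite (upper_unip_lt uU) ?mul0r // ltn_neqAle val_eqE li.
by rewrite (upper_unip_lt vU) ?mulr0 // ltn_neqAle eq_sym val_eqE lj ij.
Qed.

Lemma upper_unip_unit n (u : 'M[Qp]_n.+1) : upper_unip u -> u \in unitmx.
Proof.
move=> uU; rewrite unitmxE -det_tr det_trig; last first.
  by apply/is_trig_mxP => i j ij; rewrite mxE upper_unip_lt.
by rewrite big1 ?unitr1 // => i _; rewrite mxE upper_unip_diag.
Qed.

Lemma upper_unipV n (u : 'M[Qp]_n.+1) : upper_unip u -> upper_unip (invmx u).
Proof.
move=> uU.
(* Induction on the distance to the bottom row: row [i] of [u *m invmx u = 1] gives row [i] of the
   inverse in terms of the rows below it. *)
suff H d (i j : 'I_n.+1) : (n - i <= d)%N -> (j <= i)%N -> invmx u i j = (i == j)%:R.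
  by move=> i j; apply: (H n); rewrite leq_subr.
elim: d i j => [|d IHd] i j id ji;
  have /matrixP/(_ i j) := mulmxV (upper_unip_unit uU);
  rewrite !mxE (bigD1 i) //= upper_unip_diag // mul1r big1 ?addr0 // => l li;
  (have [il|il] := ltnP i l; last first;
    [by rewrite (upper_unip_lt uU) ?mul0r // ltn_neqAle val_eqE li|]).
  by move: id; rewrite leqn0 subn_eq0 leqNgt (leq_trans il) // -ltnS.
rewrite IHd ?(leq_trans ji (ltnW il)) //.
  by rewrite -val_eqE /= gtn_eqF ?mulr0 // (leq_ltn_trans ji).
by move: (ltn_ord l); lia.
Qed.

Lemma upper_unip3 k (a : 'M[Qp]_1) (b : 'rV[Qp]_k.+1) c d E f g h i :
  upper_unip (mx3 a b c d E f g h i) <->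
  [/\ a = 1%:M, d = 0, g = 0 & [/\ upper_unip E, h = 0 & i = 1%:M]].
Proof.
split=> [uU|[-> -> -> [uE -> ->]] r s].
- split; [| | |split].
  + by apply/matrixP => r s; rewrite !ord1 -(mx3E a b c d E f g h i) uU ?mxE.
  + by apply/matrixP => r s; rewrite !ord1 -(mx3E a b c d E f g h i) uU ?mxE.
  + by apply/matrixP => r s; rewrite !ord1 -(mx3E a b c d E f g h i) uU ?mxE.
  + by move=> r s sr; rewrite -(mx3E a b c d E f g h i) uU ?ord3_eqE.
  + by apply/matrixP => r s; rewrite !ord1 -(mx3E a b c d E f g h i) uU ?mxE ?ord3_eqE ?ord3_leE.
  + by apply/matrixP => r s; rewrite !ord1 -(mx3E a b c d E f g h i) uU ?mxE ?eqxx.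
case: (@ord3P k.+1 r) => [|r'|]; case: (@ord3P k.+1 s) => [|s'|];
  rewrite mx3E ?mxE ?ord3_eqE ?ord3_leE ?eqxx //.
exact: uE.
Qed.

End UpperUnip.

Lemma mulmx1_unitl (F : fieldType) n (x y : 'M[F]_n) :
  x *m y = 1%:M -> x \in unitmx.
Proof. by case/mulmx1_unit. Qed.

Lemma tr_mx3 (R : Type) m a b c d E f g h i :
  (@mx3 R m a b c d E f g h i)^T = mx3 a^T d^T g^T b^T E^T h^T c^T f^T i^T.
Proof. by rewrite /mx3 !tr_block_mx tr_row_mx tr_col_mx. Qed.

Lemma mx3_over (R : Type) (S : {pred R}) m a b c d E f g h i :
  (@mx3 R m a b c d E f g h i \is a mxOver S) <->
  [/\ [/\ a \is a mxOver S, b \is a mxOver S & c \is a mxOver S],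
      [/\ d \is a mxOver S, E \is a mxOver S & f \is a mxOver S]
    & [/\ g \is a mxOver S, h \is a mxOver S & i \is a mxOver S]].
Proof.
split=> [/mxOverP H|[[/mxOverP aS /mxOverP bS /mxOverP cS]
    [/mxOverP dS /mxOverP ES /mxOverP fS] [/mxOverP gS /mxOverP hS /mxOverP iS]]].
  split; split; apply/mxOverP => r s; rewrite ?(ord1 r) ?(ord1 s);
    by rewrite -(mx3E a b c d E f g h i).
by apply/mxOverP => r s; case: (ord3P r) => [|r'|]; case: (ord3P s) => [|s'|]; rewrite mx3E.
Qed.

Lemma ord3_0 k : ord0 = fst3 :> 'I_(k + 1).+1.
Proof. exact: val_inj. Qed.

Lemma ord3_max k : ord_max = lst3 :> 'I_(k + 1).+1.
Proof. by apply: val_inj; rewrite /= addn0 addn1. Qed.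

(** * Antidiagonal block matrices and the Heisenberg group *)

Section AntiHeis.
Context (F : fieldType) (m : nat).

(* Both [w_star] and [C_star *m w_star] have this shape. *)
Definition anti3 (x z : F) : 'M[F]_(1 + (m + 1)) :=
  mx3 0 0 x%:M 0 (- 1%:M) 0 z%:M 0 0.

Lemma mul_anti3_mx x z (a c g i : 'M[F]_1) (b h : 'rV[F]_m) (d f : 'cV[F]_m) E :
  anti3 x z *m mx3 a b c d E f g h i
  = mx3 (x *: g) (x *: h) (x *: i) (- d) (- E) (- f) (z *: a) (z *: b) (z *: c).
Proof.
rewrite mul_mx3 !mul0mx !mulNmx !mul1mx !mul_scalar_mx.
by rewrite ?(add0r, addr0).
Qed.

Lemma mul_mx_anti3 x z (a c g i : 'M[F]_1) (b h : 'rV[F]_m) (d f : 'cV[F]_m) E :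
  mx3 a b c d E f g h i *m anti3 x z
  = mx3 (z *: c) (- b) (x *: a) (z *: f) (- E) (x *: d) (z *: i) (- h) (x *: g).
Proof.
rewrite mul_mx3 !mulmx0 !mulmxN !mulmx1 !mul_mx_scalar.
by rewrite ?(add0r, addr0).
Qed.

Definition heis (a : 'rV[F]_m) (b : 'cV[F]_m) (c : F) : 'M[F]_(1 + (m + 1)) :=
  mx3 1%:M a c%:M 0 1%:M b 0 0 1%:M.

Lemma mul_mx_heis (a c g i : 'M[F]_1) (b h : 'rV[F]_m) (d f : 'cV[F]_m) E al be ga :
  mx3 a b c d E f g h i *m heis al be ga
  = mx3 a (a *m al + b) (ga *: a + (b *m be + c))
        d (d *m al + E) (ga *: d + (E *m be + f))
        g (g *m al + h) (ga *: g + (h *m be + i)).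
Proof.
rewrite /heis mul_mx3 !mulmx0 !mulmx1 !mul_mx_scalar.
by rewrite ?(add0r, addr0).
Qed.

Lemma heisM a b c a' b' c' :
  heis a b c *m heis a' b' c'
  = heis (a + a') (b + b') (c + c' + (a *m b') ord0 ord0).
Proof.
rewrite mul_mx_heis !mul0mx !mul1mx !scaler0 !add0r /heis.
congr mx3; apply/matrixP => i j; rewrite !ord1 ?mxE ?mulr1n ?mulr1; first exact: addrC.
  by rewrite addrA addrAC [c + c']addrC.
exact: addrC.
Qed.

Lemma heis_inj a b c a' b' c' : heis a b c = heis a' b' c' -> [/\ a = a', b = b' & c = c'].
Proof.
move=> /mx3_inj[[_ -> /matrixP/(_ ord0 ord0)]]; rewrite !mxE !mulr1n => cc.
by case=> [_ _ ->] _.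
Qed.

End AntiHeis.

(** * The group GL(Z_p) inside matrices over Q_p *)

Section GLZp.
Context (p : nat) (p_pr : prime p) (n : nat).
Local Notation Zp := (padic_int p_pr).
Local Notation Qp := (padic p_pr).
Local Notation frac := (@tofrac Zp).
Local Notation integral X := (X \is a mxOver (@Zp_int p p_pr)).
Implicit Types x y : 'M[Qp]_n.+1.

Lemma integral_map x : integral x -> exists g, x = map_mx frac g.
Proof.
move=> /mxOverP xZ.
have /choice[g gP] (ij : 'I_n.+1 * 'I_n.+1) : exists z, x ij.1 ij.2 = frac z.
  by apply/Zp_intP.
by exists (\matrix_(i, j) g (i, j)); apply/matrixP => i j; rewrite !mxE -gP.
Qed.

Lemma map_frac_inj : injective (fun g : 'M[Zp]_n.+1 => map_mx frac g).
Proof.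
move=> g h /matrixP gh; apply/matrixP => i j; apply/eqP.
by rewrite -tofrac_eq; apply/eqP; have := gh i j; rewrite !mxE.
Qed.

(** Replaces invertibility over [Z_p] by an integral inverse over [Q_p], so that later arguments
    need only entries and products in [Q_p]. *)
Lemma GL_ZpP x : GL_Zp x <-> exists y, [/\ integral x, integral y & x *m y = 1%:M].
Proof.
split=> [[g gU ->]|[y [/integral_map[g ->] /integral_map[h ->]]]].
  exists (map_mx frac (invmx g)); rewrite -map_mxM mulmxV // map_mx1.
  by split=> //; apply/mxOverP => i j; rewrite mxE Zp_int_frac.
rewrite -map_mxM -(map_mx1 frac) => /map_frac_inj/mulmx1_unit[gU _].
by exists g.
Qed.

Lemma GL_Zp_integral x : GL_Zp x -> integral x.
Proof. by move=> /GL_ZpP[y []]. Qed.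

Lemma GL_Zp_unitmx x : GL_Zp x -> x \in unitmx.
Proof. by case/GL_ZpP => y [_ _ xy]; exact: (@mulmx1_unitl Qp _ x y xy). Qed.

Lemma GL_ZpM x y : GL_Zp x -> GL_Zp y -> GL_Zp (x *m y).
Proof.
move=> /GL_ZpP[x' [xZ x'Z xx']] /GL_ZpP[y' [yZ y'Z yy']].
apply/GL_ZpP; exists (y' *m x'); rewrite !mxOverM //; split=> //.
by rewrite mulmxA -(mulmxA x) yy' mulmx1.
Qed.

Lemma GL_ZpV x : GL_Zp x -> GL_Zp (invmx x).
Proof.
move=> xG; have xU := GL_Zp_unitmx xG; have /GL_ZpP[y [xZ yZ xy]] := xG.
have -> : invmx x = y by rewrite -[invmx x]mulmx1 -xy mulKmx.
by apply/GL_ZpP; exists x; rewrite (mulmx1C xy).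
Qed.

Lemma GL_Zp1 : GL_Zp (1%:M : 'M[Qp]_n.+1).
Proof. by exists 1%:M; rewrite ?unitmx1 ?map_mx1. Qed.

End GLZp.

(** * The matrices [w_star] and [C_star], and the group U_w *)

Section Weyl.
Context (p : nat) (p_pr : prime p) (k : nat).
Local Notation Zp := (padic_int p_pr).
Local Notation Qp := (padic p_pr).
Local Notation n := (k.+1 + 1)%N.
Local Notation w := (w_star p_pr n).

Definition eps : Qp := (-1) ^+ n.

Lemma eps2 : eps * eps = 1.
Proof. by rewrite /eps -expr2 sqrr_sign. Qed.

Lemma w_starE : w = anti3 k.+1 eps 1.
Proof.
apply/matrixP => r s; rewrite mxE ord3_0 ord3_max -/eps.
case: (@ord3P k.+1 r) => [|r'|]; case: (@ord3P k.+1 s) => [|s'|];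
  by rewrite mx3E !mxE ?ord3_eqE ?eqxx ?mulr1 ?mulr0 ?oppr0 ?mulr1n.
Qed.

Lemma C_star1E : C_star p_pr (fun _ : 'I_n => 1)
  = mx3 (p%:R^-1)%:M 0 0 0 1%:M 0 0 (0 : 'rV_k.+1) (p%:R)%:M.
Proof.
(* With all [r_k = 1] the exponent at position [i] is [[i <> 0] - [i < n]]: -1 at the first
   position, 0 in the middle, 1 at the last. *)
have S1 l (i : nat) : (i <= l)%N ->
    \sum_(j < l | j.+1 == i) 1 = (i != 0%N)%:Z :> int.
  case: i => [_|i il]; first by rewrite big_pred0.
  by rewrite (big_pred1 (Ordinal il)) // => j; rewrite -val_eqE /= eqSS.
have S2 l (i : nat) : (i <= l)%N ->
    \sum_(j < l | j == i :> nat) 1 = (i < l)%N%:Z :> int.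
  rewrite leq_eqVlt => /orP[/eqP->|il].
    by rewrite big_pred0 ?ltnn // => j; rewrite ltn_eqF.
  by rewrite (big_pred1 (Ordinal il)) ?il.
rewrite /C_star; apply: diag_mx3 => [|j|]; rewrite mxE S1 ?S2 //= ?addn0 ?add1n ?addn1 ?ltnS //=.
- by rewrite -ltnS ltn_ord subrr expr0z.
- by rewrite ltnW.
- by rewrite ltnW.
- by rewrite ltnn subr0 expr1z.
Qed.

Lemma kl_matrixE : C_star p_pr (fun _ : 'I_n => 1) *m w
  = anti3 k.+1 (p%:R^-1 * eps) p%:R.
Proof.
rewrite w_starE C_star1E mul_mx_anti3 !scaler0 oppr0 /anti3 !scale_scalar_mx mul1r.
by rewrite [eps * _]mulrC.
Qed.

Lemma heis_upper (a : 'rV[Qp]_k.+1) b c : upper_unip (heis a b c).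
Proof. by apply/upper_unip3; split=> //; split=> //; apply: upper_unip1. Qed.

(** Conjugation by [w_star] exchanges the first and last indices and fixes the middle block. The
    middle block of an element of U_w is therefore both upper and lower unipotent, hence the
    identity. *)
Lemma unip_wP x : unip_w w x <-> exists a b c, x = heis a b c.
Proof.
have wU : w \in unitmx.
  apply: (@mulmx1_unitl Qp _ w (anti3 k.+1 1 eps)).
  rewrite w_starE mul_anti3_mx mx3_1 !scaler0 opprK !oppr0 !scale_scalar_mx.
  by rewrite eps2 mulr1.
split=> [[xU [v vL]]|[a [b [c ->]]]].
- move=> /(congr1 (mulmx w)); rewrite -mulmxA mulKVmx // => vw.
  have [a [b [c [d [E [f [g [h [i xE]]]]]]]]] := mx3_surj x.
  have [a' [b' [c' [d' [E' [f' [g' [h' [i' vE]]]]]]]]] := mx3_surj v^T.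
  have vE' := congr1 trmx vE; rewrite trmxK tr_mx3 in vE'.
  move: xU vL vw; rewrite /lower_unip /= vE xE vE'.
  move=> /upper_unip3[-> -> -> [EU -> ->]] /upper_unip3[-> -> -> [E'U -> ->]].
  rewrite w_starE mul_anti3_mx mul_mx_anti3 => /mx3_inj[_ [_ /oppr_inj EE _] _].
  exists b, f, (c ord0 ord0); rewrite /heis -mx11_scalar; congr (mx3 _ _ _ _ _ _ _ _ _).
  apply/matrixP => r s; rewrite mxE; have [sr|rs] := leqP s r; first exact: EU.
  by rewrite -EE mxE E'U 1?ltnW // eq_sym.
- split; first exact: heis_upper.
  (* The witness is [w x w^-1] for [x = heis a b c], computed blockwise. *)
  exists (mx3 1%:M 0 0 (- (eps *: b)) 1%:M 0 (eps * c)%:M (- a) 1%:M).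
    rewrite /lower_unip /= tr_mx3 !(trmx0, trmx1); apply/upper_unip3.
    by split=> //; split=> //; apply: upper_unip1.
  rewrite -mulmxA -[RHS](mulKmx wU); congr (_ *m _).
  rewrite w_starE mul_anti3_mx mul_mx_anti3 !scale1r !scaler0 !oppr0 opprK.
  rewrite !scale_scalar_mx !mulr1 mulrA eps2 mul1r scalerN scalerA eps2 scale1r.
  by [].
Qed.

End Weyl.

Lemma mul_invmx_scale (F : fieldType) n (mu u h de : 'M[F]_n) (q : F) :
  u \in unitmx -> u *m h \in unitmx -> mu *m h = q *: de ->
  mu *m invmx u = q *: (de *m invmx (u *m h)).
Proof.
move=> uU uhU muh; apply: (can_inj (mulmxK uhU)).
by rewrite -scalemxAl mulmxKV // mulmxA mulmxKV.
Qed.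

Lemma scale_mx3 (R : pzRingType) m x a b c d E f g h i :
  x *: @mx3 R m a b c d E f g h i = mx3 (x *: a) (x *: b) (x *: c)
    (x *: d) (x *: E) (x *: f) (x *: g) (x *: h) (x *: i).
Proof. by rewrite /mx3 !scale_block_mx scale_row_mx scale_col_mx. Qed.

(** * The Bruhat cell *)

Section BigCell.
Context (F : fieldType) (m : nat).

(** Solves for [u] so that [u N u'] becomes block lower triangular, given [A B = 0]. The middle row
    is to be [(B / C, -1, 0)], which forces the last column [f = B / (q C)] and the block [1 + f A];
    the first row is to be [(- ep / C, 0, 0)]. *)
Definition big_cell_u (q ep C : F) (B : 'cV[F]_m) (A : 'rV[F]_m) : 'M[F]_(1 + (m + 1)) :=
  mx3 1%:M ((- ep / (q * C)) *: A) (- ep / (q * C))%:M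
      0 (1%:M + ((q * C)^-1 *: B) *m A) ((q * C)^-1 *: B)
      0 0 1%:M.

Definition big_cell (q ep C : F) (B : 'cV[F]_m) (A : 'rV[F]_m) : 'M[F]_(1 + (m + 1)) :=
  mx3 (- ep / C)%:M 0 0 (C^-1 *: B) (- 1%:M) 0 q%:M A C%:M.

Lemma big_cellE q ep C B A : q != 0 -> C != 0 -> A *m B = 0 ->
  big_cell_u q ep C B A *m anti3 m (q^-1 * ep) q
    *m heis (q^-1 *: A) (q^-1 *: B) (q^-1 * C) = big_cell q ep C B A.
Proof.
move=> q0 C0 AB; rewrite mul_mx_anti3 mul_mx_heis /big_cell.
rewrite !scaler0 !oppr0 !mul0mx !addr0 !scale_scalar_mx.
have qs : q * (- ep / (q * C)) = - ep / C by field; rewrite q0 C0.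
have qC : q * (q * C)^-1 = C^-1 by field; rewrite q0 C0.
congr mx3; rewrite ?mulr1 ?qs //.
- rewrite mul_scalar_mx scalerA -scalerBl (_ : _ - _ = 0) ?scale0r //.
  by field; rewrite q0 C0.
- rewrite mulNmx -!scalemxAl -scalemxAr AB !scaler0 oppr0 add0r -raddfD /=.
  rewrite (_ : _ + _ = 0) ?raddf0 //; by field; rewrite q0 C0.
- by rewrite scalerA qC.
- rewrite scalerA qC -scalemxAr -!scalemxAl scalerA opprD addrCA -scalerBl.
  by rewrite -invfM subrr scale0r addr0.
- rewrite mulNmx mulmxDl mul1mx -mulmxA -scalemxAr AB scaler0 mulmx0 addr0.
  rewrite !scalerA -scalerBl (_ : _ - _ = 0) ?scale0r //.
  by field; rewrite q0 C0.
- by rewrite mul_scalar_mx scalerA divff // scale1r.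
- by rewrite mulrAC mulVf // mul1r.
Qed.

(** The inverse is written out because its entries are visibly integral once [C] is a unit, which is
    what [cell_GL] needs. *)
Lemma big_cell_inv q ep C B A : C != 0 -> ep * ep = 1 -> A *m B = 0 ->
  big_cell q ep C B A *m
  mx3 (- ep * C)%:M 0 0 (- ep *: B) (- 1%:M) 0 (q * ep)%:M (C^-1 *: A) (C^-1)%:M = 1%:M.
Proof.
move=> C0 ep2 AB; rewrite mul_mx3 !(mulmx0, mul0mx, addr0, add0r) mx3_1.
rewrite -!scalar_mxM !mulNmx !mulmxN !mul1mx !mulmx1 !mul_scalar_mx !mul_mx_scalar.
rewrite -!scalemxAr AB scaler0 add0r opprK !scalerA.
congr mx3.
- by rewrite (_ : _ * _ = 1) //; rewrite -ep2; field.
- rewrite -[- (- ep *: B)]scaleNr -scalerDl (_ : _ + _ = 0) ?scale0r //; by field.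
- by rewrite -raddfD /= (_ : _ + _ = 0) ?raddf0 //; ring.
- by rewrite divff // scale1r addNr.
- by rewrite divff.
Qed.

(* Comparing the last two block rows of [U N h = N h'] gives everything. *)
Lemma anti3_heis_uniq (x z : F) (b : 'rV[F]_m) c (E : 'M[F]_m) f al be ga al' be' ga' :
  z != 0 ->
  mx3 1%:M b c 0 E f 0 0 1%:M *m anti3 m x z *m heis al be ga
    = anti3 m x z *m heis al' be' ga' ->
  heis al be ga = heis al' be' ga'.
Proof.
move=> z0; rewrite mul_mx_anti3 mul_mx_heis mul_anti3_mx.
rewrite !scaler0 !oppr0 !mul0mx !addr0.
case/mx3_inj => _ [/eqP]; rewrite scaler_eq0 (negbTE z0) /= => /eqP ->.
rewrite scaler0 mul0mx add0r scaler0 add0r => /oppr_inj -> + [_].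
rewrite mulNmx mul1mx => /oppr_inj -> .
rewrite -scalemxAl mul1mx => /(scalerI z0) -> /matrixP/(_ ord0 ord0).
by rewrite !mxE !mulr1n mulr1 [RHS]mulrC => /(mulIf z0) ->.
Qed.

End BigCell.

(** * Moving factors across [N] in products [u N v] *)

Section BruhatAlgebra.
Context (F : fieldType).

Lemma mul_unitmxI n (u u' x : 'M[F]_n) : u *m x \in unitmx -> u *m x = u' *m x -> u = u'.
Proof. by rewrite unitmx_mul => /andP[_ xU] /(can_inj (mulmxK xU)). Qed.

Lemma bruhat_left_cancel n (u u' x h h' : 'M[F]_n) : u' \in unitmx ->
  u *m x *m h = u' *m x *m h' -> invmx u' *m u *m x *m h = x *m h'.
Proof.
by move=> u'U; rewrite -!mulmxA => /(congr1 (mulmx (invmx u'))); rewrite mulKmx.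
Qed.

Lemma bruhat_inv_mul n (u x h x' h' : 'M[F]_n) : u *m x *m h \in unitmx ->
  x *m x' = 1%:M -> h *m h' = 1%:M -> invmx (u *m x *m h) *m u = h' *m x'.
Proof.
move=> uxhU xx' hh'; rewrite -[RHS](mulKmx uxhU); congr (_ *m _).
by rewrite -!mulmxA (mulmxA h) hh' mul1mx xx' mulmx1.
Qed.

Lemma bruhat_same_heis n (u u' x h : 'M[F]_n) :
  u *m x *m h \in unitmx -> u' *m x *m h = u' *m invmx u *m (u *m x *m h).
Proof.
by rewrite !unitmx_mul => /andP[/andP[uU _] _]; rewrite !mulmxA mulmxKV.
Qed.

Lemma anti3_mul_inv m (x z : F) : x != 0 -> z != 0 ->
  anti3 m x z *m anti3 m z^-1 x^-1 = 1%:M.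
Proof.
move=> x0 z0; rewrite mul_anti3_mx mx3_1 !scaler0 !oppr0 opprK !scale_scalar_mx.
by rewrite !divff.
Qed.

Lemma upper_mx3_split m (a c : 'M[F]_1) (b : 'rV[F]_m) E f : E \in unitmx ->
  mx3 1%:M b c 0 E f 0 0 1%:M
  = mx3 1%:M 0 0 0 E 0 0 0 1%:M *m heis b (invmx E *m f) (c ord0 ord0).
Proof.
move=> EU; rewrite mul_mx_heis !mul0mx !mul1mx !scaler0 !addr0 !add0r mulKVmx //.
by rewrite scale_scalar_mx mulr1 -mx11_scalar.
Qed.

Lemma anti3_mid_comm m (x z : F) (E : 'M[F]_m) :
  anti3 m x z *m mx3 1%:M 0 0 0 E 0 0 0 1%:M = mx3 1%:M 0 0 0 E 0 0 0 1%:M *m anti3 m x z.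
Proof. by rewrite mul_anti3_mx mul_mx_anti3 !scaler0 !oppr0. Qed.

Lemma heis_mulV m (a : 'rV[F]_m) b c :
  heis a b c *m heis (- a) (- b) ((a *m b) ord0 ord0 - c) = 1%:M.
Proof.
have E : (a *m - b) ord0 ord0 = - (a *m b) ord0 ord0 by rewrite mulmxN mxE.
rewrite heisM !subrr E addrCA subrr addr0 subrr.
by rewrite /heis mx3_1 raddf0.
Qed.

(** An upper unipotent matrix is a middle block times a Heisenberg element, and the middle block
    commutes with [N]. Moving it into the left factor puts the right factor in U_w. *)
Lemma bruhat_upper_heis m (u : 'M[F]_(1 + (m + 1))) x z (b : 'rV[F]_m) c E f :
  E \in unitmx ->
  u *m anti3 m x z *m mx3 1%:M b c 0 E f 0 0 1%:M
  = u *m mx3 1%:M 0 0 0 E 0 0 0 1%:M *m anti3 m x z *m heis b (invmx E *m f) (c ord0 ord0).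
Proof. by move=> EU; rewrite upper_mx3_split // mulmxA -(mulmxA u) anti3_mid_comm mulmxA. Qed.

Lemma mulmx_tail n (a b h t : 'M[F]_n) : b *m h = t -> a *m b *m h = a *m t.
Proof. by move=> <-; rewrite mulmxA. Qed.

Lemma double_coset_back n (x y g h g' h' : 'M[F]_n) : g \in unitmx -> h \in unitmx ->
  y = g *m x *m h -> g' *m invmx g *m y *m (invmx h *m h') = g' *m x *m h'.
Proof.
by move=> gU hU ->; rewrite !mulmxA mulmxKV // -!mulmxA mulKVmx // !mulmxA.
Qed.

Lemma double_coset_fwd n (x y g h g' h' : 'M[F]_n) :
  y = g *m x *m h -> g' *m g *m x *m (h *m h') = g' *m y *m h'.
Proof. by move=> ->; rewrite !mulmxA. Qed.

Lemma bruhat_mulmx n (x u N v g h : 'M[F]_n) : u *m N *m v = x ->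
  g *m x *m h = g *m u *m N *m (v *m h).
Proof. by move=> <-; rewrite !mulmxA. Qed.

Lemma mulmx_head n (g x h z : 'M[F]_n) : z = x *m h -> g *m z = g *m x *m h.
Proof. by move=> ->; rewrite mulmxA. Qed.

End BruhatAlgebra.

(** The [term_] identities pull the denominator [q] out of a superdiagonal term, giving the shape to
    which [padic_char_divp] applies. *)
Lemma term_u (F : fieldType) (x e c a q : F) : x * (- e / (q * c) * a) = x * (- e * c^-1 * a) / q.
Proof. by rewrite invfM; ring. Qed.

Lemma term_E (F : fieldType) (x c a b q : F) : x * ((q * c)^-1 * b * a) = x * (c^-1 * b * a) / q.
Proof. by rewrite invfM; ring. Qed.

Lemma term_v (F : fieldType) (x c b q : F) : x * ((q * c)^-1 * b) = x * (c^-1 * b) / q.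
Proof. by rewrite invfM; ring. Qed.

Lemma term_heis (F : fieldType) (x b q : F) : x * (q^-1 * b) = x * b / q.
Proof. by ring. Qed.

(** * Explicit representatives of the double cosets *)

Section Cells.
Context (p : nat) (p_pr : prime p) (k : nat).
Local Notation Qp := (padic p_pr).
Local Notation m := k.+1.
Local Notation n := (k.+1 + 1)%N.
Local Notation w := (w_star p_pr n).
Local Notation ep := (eps p_pr k).
Local Notation integral X := (X \is a mxOver (@Zp_int p p_pr)).
Local Notation V := {ffun 'I_m -> 'F_p}.
Local Notation N := (anti3 m (p%:R^-1 * ep) p%:R : 'M[Qp]_n.+1).

Definition liftF (a : 'F_p) : Qp := (nat_of_ord a)%:R.
Definition liftr (A : V) : 'rV[Qp]_m := \row_j liftF (A j).
Definition liftc (B : V) : 'cV[Qp]_m := \col_i liftF (B i).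

Lemma nat_Zp_int (a : nat) : a%:R \in @Zp_int p p_pr.
Proof. exact: rpred_nat. Qed.

Lemma liftF_int a : liftF a \in Zp_int.
Proof. exact: nat_Zp_int. Qed.

Lemma liftr_int A : integral (liftr A).
Proof. by apply/mxOverP => i j; rewrite mxE liftF_int. Qed.

Lemma liftc_int A : integral (liftc A).
Proof. by apply/mxOverP => i j; rewrite mxE liftF_int. Qed.

Lemma liftF0 : liftF 0 = 0. Proof. by []. Qed.

Lemma liftF_neq0 a : a != 0 -> liftF a != 0.
Proof. exact: lift_Fp_neq0. Qed.

Lemma liftFV_int a : a != 0 -> (liftF a)^-1 \in Zp_int.
Proof. exact: lift_Fp_inv_int. Qed.

Lemma liftF_divp a : (p%:R^-1 * liftF a \in Zp_int) = (a == 0).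
Proof. by rewrite mulrC -(lift_Fp_inj p_pr a 0) mul0r subr0. Qed.

Lemma eps_int : ep \in Zp_int.
Proof. by rewrite /eps rpredX // rpredN rpred1. Qed.

(** The chosen lift of 0 is 0 itself, so the product vanishes in [Q_p] and not merely modulo [p], as
    [big_cellE] requires. *)
Lemma liftr_mul_liftc (A B : V) : strictly_below B A -> liftr A *m liftc B = 0.
Proof.
move=> /strictly_belowP BA; apply/matrixP => i j; rewrite !mxE big1 // => l _.
rewrite !mxE; apply/eqP; rewrite mulf_eq0.
by case/orP: (BA l l (leqnn _)) => /eqP->; rewrite eqxx ?orbT.
Qed.

Lemma heis_unip_w (a : 'rV[Qp]_m) b c : unip_w w (heis a b c).
Proof. by apply/unip_wP; exists a, b, c. Qed.

Lemma Zp_int_mx0 r s : integral (0 : 'M[Qp]_(r, s)).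
Proof. by apply/mxOverP => i j; rewrite mxE rpred0. Qed.

Lemma Zp_int_scalar_mx r x : x \in Zp_int -> integral (x%:M : 'M[Qp]_r).
Proof. by move=> xZ; apply/mxOverP => i j; rewrite mxE rpredMn. Qed.

Lemma Zp_int_scale_mx r s x (X : 'M[Qp]_(r, s)) : x \in Zp_int -> integral X -> integral (x *: X).
Proof. by move=> xZ /mxOverP XZ; apply/mxOverP => i j; rewrite mxE rpredM. Qed.

Lemma heis_GL (a : 'rV[Qp]_m) b c : integral a -> integral b -> c \in Zp_int ->
  GL_Zp (heis a b c).
Proof.
move=> aZ bZ cZ; apply/GL_ZpP; exists (heis (- a) (- b) ((a *m b) ord0 ord0 - c)).
have abZ : (a *m b) ord0 ord0 \in Zp_int by apply/mxOverP/mxOverM.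
split; last exact: heis_mulV.
- by apply/mx3_over; split; split; rewrite ?Zp_int_mx0 ?Zp_int_scalar_mx ?rpred1.
- apply/mx3_over; split; split;
    by rewrite ?rpredN ?Zp_int_mx0 ?Zp_int_scalar_mx ?rpred1 ?rpredB.
Qed.

Definition cell_u (t : 'F_p * (V * V)) : 'M[Qp]_n.+1 :=
  big_cell_u p%:R ep (liftF t.1) (liftc t.2.1) (liftr t.2.2).
Definition cell_heis (t : 'F_p * (V * V)) : 'M[Qp]_n.+1 :=
  heis (p%:R^-1 *: liftr t.2.2) (p%:R^-1 *: liftc t.2.1) (p%:R^-1 * liftF t.1).
Definition cell (t : 'F_p * (V * V)) : 'M[Qp]_n.+1 :=
  big_cell p%:R ep (liftF t.1) (liftc t.2.1) (liftr t.2.2).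

Definition admissible (t : 'F_p * (V * V)) : bool :=
  (t.1 != 0) && strictly_below t.2.1 t.2.2.

Lemma cellE t : admissible t -> cell_u t *m N *m cell_heis t = cell t.
Proof.
move=> /andP[C0 BA]; apply: big_cellE; first exact: frac_p_neq0.
  exact: liftF_neq0.
exact: liftr_mul_liftc.
Qed.

Lemma cell_u_upper t : admissible t -> upper_unip (cell_u t).
Proof.
case: t => C [B A] /andP[C0 /= /strictly_belowP BA].
apply/upper_unip3; split=> //; split=> // i j ji.
rewrite !mxE big_ord1 !mxE; case/orP: (BA i j ji) => /eqP->.
  by rewrite liftF0 mulr0 addr0.
by rewrite liftF0 mulr0 mul0r addr0.
Qed.

Lemma cell_GL t : admissible t -> GL_Zp (cell t).
Proof.
case: t => C [B A] /andP[C0 /= BA]; apply/GL_ZpP; eexists; split; last first.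
- apply: big_cell_inv; [exact: liftF_neq0|exact: eps2|exact: liftr_mul_liftc].
- apply/mx3_over; split; split;
    rewrite ?Zp_int_mx0 ?Zp_int_scalar_mx ?Zp_int_scale_mx ?rpredM ?rpredN ?rpred1
      ?Zp_int_scalar_mx ?eps_int ?liftF_int ?liftFV_int ?liftr_int ?liftc_int ?nat_Zp_int //.
- apply/mx3_over; split; split;
    rewrite ?Zp_int_mx0 ?Zp_int_scalar_mx ?Zp_int_scale_mx ?rpredM ?rpredN ?rpred1
      ?Zp_int_scalar_mx ?eps_int ?liftF_int ?liftFV_int ?liftr_int ?liftc_int ?nat_Zp_int //.
Qed.

End Cells.

(** * The quotient X(N) is parametrised by the admissible triples *)

Section KloostermanCells.
Context (p : nat) (p_pr : prime p) (k : nat).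
Local Notation Zp := (padic_int p_pr).
Local Notation Qp := (padic p_pr).
Local Notation frac := (@tofrac Zp).
Local Notation m := k.+1.
Local Notation n := (k.+1 + 1)%N.
Local Notation w := (w_star p_pr n).
Local Notation ep := (eps p_pr k).
Local Notation integral X := (X \is a mxOver (@Zp_int p p_pr)).
Local Notation V := {ffun 'I_m -> 'F_p}.
Local Notation N := (anti3 m (p%:R^-1 * ep) p%:R : 'M[Qp]_n.+1).
Local Notation liftF := (@liftF p p_pr).
Local Notation liftr := (@liftr p p_pr k).
Local Notation liftc := (@liftc p p_pr k).
Local Notation cell := (@cell p p_pr k).
Local Notation cell_u := (@cell_u p p_pr k).
Local Notation cell_heis := (@cell_heis p p_pr k).

(** Back substitution from the last row up to row [j]; the diagonal is 1, so no division occurs. *)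
Lemma upper_unip_int_solve (E : 'M[Qp]_m) (b : 'cV[Qp]_m) (j : 'I_m) :
  upper_unip E ->
  (forall i l : 'I_m, (j <= i)%N -> E i l \in Zp_int) ->
  (forall i : 'I_m, (j <= i)%N -> (E *m b) i ord0 \in Zp_int) ->
  forall i : 'I_m, (j <= i)%N -> b i ord0 \in Zp_int.
Proof.
move=> EU EZ EbZ.
suff H d (i : 'I_m) : (m - i <= d)%N -> (j <= i)%N -> b i ord0 \in Zp_int.
  by move=> i; apply: (H m); rewrite leq_subr.
elim: d i => [|d IHd] i id ji.
  by move: id (ltn_ord i); rewrite leqn0 subn_eq0 leqNgt => /negP.
have := EbZ i ji; rewrite mxE (bigD1 i) //= upper_unip_diag // mul1r.
rewrite rpredDr // rpred_sum // => l li.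
have [il|il] := ltnP i l; last first.
  by rewrite (upper_unip_lt EU) ?mul0r ?rpred0 // ltn_neqAle val_eqE li.
rewrite rpredM ?EZ // IHd //; first by move: (ltn_ord l); lia.
by rewrite (leq_trans ji) // ltnW.
Qed.

(** Suppose [A_s <> 0], so that its lift is a unit. For [r >= s] the entry [E_(r,s)] is 0 or 1, so
    integrality of [f_r A_s - E_(r,s)] makes [f_r] integral. Then rows [r >= s] of [E] are integral,
    and by the last column so are those of [E (B / p)]. Back substitution makes [B_r / p] integral,
    that is [B_r = 0]. *)
Lemma cell_strictly_below u t : upper_unip u -> integral (u *m N *m cell_heis t) ->
  strictly_below t.2.1 t.2.2.
Proof.
case: t => C [B A] uU; have [a [b [c [d [E [f [g [h [i uE]]]]]]]]] := mx3_surj u.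
move: uU; rewrite uE => /upper_unip3[-> -> -> [EU -> ->]].
rewrite /cell_heis /= mul_mx_anti3 mul_mx_heis.
have p0 := frac_p_neq0 p_pr.
case/mx3_over => _ [_ /mxOverP E1 /mxOverP E2] _.
have {}E1 r s : f r ord0 * liftF (A s) - E r s \in Zp_int.
  have := E1 r s; rewrite -scalemxAl -scalemxAr scalerA divff // scale1r.
  by rewrite !mxE big_ord1 !mxE.
have {}E2 r : liftF C * f r ord0 - (E *m (p%:R^-1 *: liftc B)) r ord0 \in Zp_int.
  have := E2 r ord0; rewrite scaler0 addr0 scalerA mulrAC mulVf // mul1r mulNmx.
  by rewrite mxE [(liftF C *: f) _ _]mxE [(- (E *m _)) _ _]mxE.
apply/strictly_belowP => r s sr; have [//|As0] := eqVneq (A s) 0.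
have fZ (l : 'I_m) : (s <= l)%N -> f l ord0 \in Zp_int.
  move=> sl; rewrite -[f l ord0](mulfK (lift_Fp_neq0 p_pr As0)) rpredM ?lift_Fp_inv_int //.
  by have := E1 l s; rewrite rpredBr // EU // rpred_nat.
have EZ (l l' : 'I_m) : (s <= l)%N -> E l l' \in Zp_int.
  by move=> sl; have := E1 l l'; rewrite rpredBl // rpredM ?fZ // liftF_int.
have : (p%:R^-1 *: liftc B) r ord0 \in Zp_int.
  apply: (@upper_unip_int_solve E _ s) => // l sl.
  by have := E2 l; rewrite rpredBl // rpredM ?fZ // liftF_int.
by rewrite !mxE liftF_divp.
Qed.

(* With mu = (0, A, 1) and p | C, mu u^-1 = p e_0 x^-1 is divisible by p, but its
   first nonzero entry is that of mu, a unit. *)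
Lemma cell_neq0 u t : upper_unip u -> GL_Zp (u *m N *m cell_heis t) ->
  strictly_below t.2.1 t.2.2 -> t.1 != 0.
Proof.
case: t => C [B A] uU xG /= BA; apply/negP => /eqP C0; subst C.
have p0 := frac_p_neq0 p_pr.
set x := u *m N *m _ in xG.
pose mu : 'M[Qp]_n.+1 := mx3 0 0 0 0 0 0 0 (liftr A) 1%:M.
pose de : 'M[Qp]_n.+1 := mx3 0 0 0 0 0 0 1%:M (0 : 'rV_m) 0.
have muN : mu *m N *m cell_heis (0, (B, A)) = p%:R *: de.
  rewrite /cell_heis /mu mul_mx_anti3 mul_mx_heis /= liftF0 mulr0 !scale0r.
  rewrite !scaler0 !oppr0 !mul0mx !addr0 !add0r.
  rewrite -scalemxAl -scalemxAr mul1mx scalerA divff // scale1r subrr.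
  rewrite mulNmx -scalemxAr liftr_mul_liftc // scaler0 oppr0.
  by apply: etrans (esym (scale_mx3 _ _ _ _ _ _ _ _ _ _)); rewrite !scaler0.
pose L := mu *m invmx u.
have Lp i j : p%:R^-1 * L i j \in Zp_int.
  have -> : L = p%:R *: (de *m invmx (u *m (N *m cell_heis (0, (B, A))))).
    apply: (@mul_invmx_scale Qp _ mu u (N *m cell_heis (0, (B, A))) de p%:R).
    - exact: upper_unip_unit.
    - by have := GL_Zp_unitmx xG; rewrite /x mulmxA.
    - by rewrite mulmxA.
  rewrite mxE mulrA mulVf // mul1r.
  have deZ : integral de.
    by rewrite /de; apply/mx3_over; split; split; rewrite ?Zp_int_mx0 ?Zp_int_scalar_mx ?rpred1.
  have xVZ : integral (invmx (u *m (N *m cell_heis (0, (B, A))))).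
    by apply/GL_Zp_integral/GL_ZpV; rewrite mulmxA.
  by apply/mxOverP/mxOverM.
have mu_lst : mu lst3 lst3 != 0 by rewrite /mu mx3E mxE eqxx oner_eq0.
pose t := [arg min_(i < (lst3 : 'I_n.+1) | mu lst3 i != 0) (i : nat)].
have [mut tmin] : mu lst3 t != 0 /\ forall i : 'I_n.+1, mu lst3 i != 0 -> (t <= i)%N.
  by rewrite /t; case: arg_minnP.
have : p%:R^-1 * mu lst3 t \in Zp_int.
  have <- : L lst3 t = mu lst3 t; last exact: Lp.
  have VU := upper_unipV uU.
  rewrite mxE (bigD1 t) //= upper_unip_diag // mulr1 big1 ?addr0 // => i it.
  have [ti|ti] := ltnP t i; first by rewrite (upper_unip_lt VU) ?mulr0.
  have [->|/tmin ti'] := eqVneq (mu lst3 i) 0; first by rewrite mul0r.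
  by case/eqP: it; apply/val_inj/eqP; rewrite /= eqn_leq ti.
move: mut; rewrite /mu; case: (@ord3P m t) => [|j|]; rewrite mx3E ?mxE ?eqxx //.
  by rewrite liftF_divp => /[swap] /eqP ->; rewrite liftF0 eqxx.
move=> _; rewrite -[1]/(liftF 1) liftF_divp => /eqP.
by move/eqP; rewrite oner_eq0.
Qed.

Lemma cell_uniq u u' (a a' : 'rV[Qp]_m) b b' c c' : upper_unip u -> upper_unip u' ->
  u *m N *m heis a b c \in unitmx ->
  u *m N *m heis a b c = u' *m N *m heis a' b' c' ->
  u = u' /\ heis a b c = heis a' b' c'.
Proof.
move=> uU u'U xU xE; have p0 := frac_p_neq0 p_pr.
have hE : heis a b c = heis a' b' c'.
  have := bruhat_left_cancel (upper_unip_unit u'U) xE.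
  have := upper_unipM (upper_unipV u'U) uU.
  have [a1 [b1 [c1 [d1 [E [f [g [h [i ->]]]]]]]]] := mx3_surj (invmx u' *m u).
  by move=> /upper_unip3[-> -> -> [_ -> ->]]; apply: anti3_heis_uniq.
split=> //; apply: (@mul_unitmxI Qp _ u u' (N *m heis a b c)); first by rewrite mulmxA.
by rewrite !mulmxA xE hE.
Qed.

(** The last row of [u] is trivial, so the last row of [x = u N u'] is [(p, p a, p c)]. For [b], the
    first column of [u] is trivial, so the first column of [x^-1] is that of [u'^-1 N^-1], whose
    middle part is [p b] up to sign. *)
Lemma cell_integral u (a : 'rV[Qp]_m) b c : upper_unip u ->
  GL_Zp (u *m N *m heis a b c) ->
  [/\ integral (p%:R *: a), integral (p%:R *: b) & p%:R * c \in Zp_int].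
Proof.
move=> uU xG; have p0 := frac_p_neq0 p_pr.
have ep0 : ep != 0 by apply: contraNneq (oner_neq0 Qp) => ep0; rewrite -(eps2 p_pr k) ep0 mulr0.
have x0 : p%:R^-1 * ep != 0 by rewrite mulf_neq0 ?invr_eq0.
have := bruhat_inv_mul (GL_Zp_unitmx xG) (anti3_mul_inv m x0 p0) (heis_mulV a b c).
have := GL_Zp_integral (GL_ZpV xG); have := GL_Zp_integral xG.
move: (invmx _) => y.
have [a1 [b1 [c1 [d1 [E1 [f1 [g1 [h1 [i1 ->]]]]]]]]] := mx3_surj y.
have [a2 [b2 [c2 [d2 [E2 [f2 [g2 [h2 [i2 uE]]]]]]]]] := mx3_surj u.
move: uU; rewrite uE => /upper_unip3[-> -> -> [EU -> ->]].
rewrite mul_mx_anti3 mul_mx_heis !scale_scalar_mx => /mx3_over[_ _ [_ aZ cZ]].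
move=> /mx3_over[_ [dZ _ _] _].
rewrite mul_mx3 /heis mul_mx_anti3 => /mx3_inj[_ [dE _ _] _].
split.
- by move: aZ; rewrite mulr1 mul_scalar_mx oppr0 addr0.
- move: dE; rewrite mulmx1 !mulmx0 !addr0 invfM invrK => dE.
  have -> : p%:R *: b = - ep *: d1.
    by rewrite dE !scalerN scaleNr opprK scalerA mulrCA divff // mulr1.
  by rewrite Zp_int_scale_mx ?rpredN ?eps_int.
- move: cZ => /mxOverP/(_ ord0 ord0); rewrite oppr0 mul0mx scaler0 !addr0.
  by rewrite mulr1 mxE mulr1n mulrC.
Qed.

Lemma round_exists r s (X : 'M[Qp]_(r, s)) : integral (p%:R *: X) ->
  exists Y : 'I_r -> 'I_s -> 'F_p, integral (p%:R^-1 *: (\matrix_(i, j) liftF (Y i j)) - X).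
Proof.
move=> /mxOverP XZ.
have /choice[Y YP] (ij : 'I_r * 'I_s) : exists y : 'F_p,
    X ij.1 ij.2 - (nat_of_ord y)%:R / p%:R \in Zp_int.
  by apply: lift_Fp_exists; have := XZ ij.1 ij.2; rewrite mxE.
exists (fun i j => Y (i, j)); apply/mxOverP => i j; rewrite !mxE -opprB rpredN.
by have := YP (i, j); rewrite [_ / _]mulrC.
Qed.

Lemma heis_round u (a : 'rV[Qp]_m) b c : upper_unip u ->
  GL_Zp (u *m N *m heis a b c) ->
  exists t h, [/\ unip_w w h, GL_Zp h & heis a b c *m h = cell_heis t].
Proof.
move=> uU xG; have [aZ bZ cZ] := cell_integral uU xG.
have [A AZ] := round_exists aZ; have [B BZ] := round_exists bZ.
pose be := p%:R^-1 *: (\matrix_(i, j) liftF (B i j)) - b.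
(* Correcting [b] by [be] adds [a be] to the corner, so it is [c + a be] that gets rounded. It stays
   in [p^-1 Z_p] because [p a] and [be] are integral. *)
have c1Z : p%:R * (c + (a *m be) ord0 ord0) \in Zp_int.
  rewrite mulrDr rpredD //.
  have : integral ((p%:R *: a) *m be) by apply: mxOverM.
  by move=> /mxOverP/(_ ord0 ord0); rewrite -scalemxAl mxE.
have [C CZ] := lift_Fp_exists c1Z.
exists (C, ([ffun i => B i ord0], [ffun j => A ord0 j])).
exists (heis (p%:R^-1 *: (\matrix_(i, j) liftF (A i j)) - a) be
   (p%:R^-1 * liftF C - (c + (a *m be) ord0 ord0))); split.
- exact: heis_unip_w.
- apply: heis_GL => //; rewrite -opprB rpredN.
  by move: CZ; rewrite [_ / _]mulrC.
- have addBK (U : zmodType) (x y : U) : x + (y - x) = y by rewrite addrCA subrr addr0.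
  have EA : liftr [ffun j => A ord0 j] = \matrix_(i, j) liftF (A i j).
    by apply/matrixP => i j; rewrite !mxE ffunE (ord1 i).
  have EB : liftc [ffun i => B i ord0] = \matrix_(i, j) liftF (B i j).
    by apply/matrixP => i j; rewrite !mxE ffunE (ord1 j).
  rewrite heisM addBK addBK addrAC addBK /cell_heis /= EA EB.
  reflexivity.
Qed.

(** After [u'] is moved into U_w and rounded to [cell_heis t], the resulting matrix and [cell t]
    have the same right part. They differ by the left factor [cell_u t *m invmx u1], which is
    unipotent, and integral as a quotient of two elements of GL(Z_p). *)
Lemma kl_set_cell x :
  kl_set N x -> exists t g h, [/\ admissible t, upper_unip g, GL_Zp g, unip_w w h /\ GL_Zp h
    & cell t = g *m x *m h].
Proof.
case=> [[u uU [v vU xE]] xG].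
have [a1 [b1 [c1 [d1 [E1 [f1 [g1 [h1 [i1 vE]]]]]]]]] := mx3_surj v.
move: vU xE; rewrite vE => /upper_unip3[-> -> -> [EU -> ->]].
rewrite (bruhat_upper_heis _ _ _ _ _ _ (upper_unip_unit EU)).
set u1 := u *m _; set b := invmx _ *m _; set c := c1 _ _ => xE.
have u1U : upper_unip u1.
  apply: upper_unipM uU _; apply/upper_unip3; split=> //; split=> //.
rewrite -xE in xG.
have [t [h [hU hG hE]]] := heis_round u1U xG.
have yE := mulmx_tail (u1 *m N) hE.
have yG : GL_Zp (u1 *m N *m cell_heis t) by rewrite -yE; apply: GL_ZpM.
have BA := cell_strictly_below u1U (GL_Zp_integral yG).
have C0 := cell_neq0 u1U yG BA.
have tA : admissible t by rewrite /admissible C0.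
have cE := etrans (esym (cellE p_pr tA)) (bruhat_same_heis (cell_u t) (GL_Zp_unitmx yG)).
exists t, (cell_u t *m invmx u1), h; split; [exact: tA| | |exact: conj|].
- by apply: upper_unipM (upper_unipV u1U); apply: cell_u_upper.
- have -> : cell_u t *m invmx u1 = cell t *m invmx (u1 *m N *m cell_heis t).
    by rewrite cE (mulmxK (GL_Zp_unitmx yG)).
  exact: GL_ZpM (cell_GL p_pr tA) (GL_ZpV yG).
- have zE := etrans (esym yE) (congr1 (mulmx^~ h) xE).
  exact: etrans cE (mulmx_head _ zE).
Qed.

Lemma unip_wM h h' : unip_w w h -> unip_w w h' -> unip_w w (h *m h').
Proof.
move=> /unip_wP[a [b [c ->]]] /unip_wP[a' [b' [c' ->]]]; rewrite heisM.
exact: heis_unip_w.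
Qed.

Lemma unip_wV h : unip_w w h -> unip_w w (invmx h).
Proof.
move=> /unip_wP[a [b [c ->]]].
have hU := upper_unip_unit (heis_upper a b c).
have -> : invmx (heis a b c) = heis (- a) (- b) ((a *m b) ord0 ord0 - c).
  by rewrite -[invmx _]mulmx1 -(heis_mulV a b c) mulKmx.
exact: heis_unip_w.
Qed.

Lemma kl_double_coset_eq x y g h : upper_unip g -> GL_Zp g -> unip_w w h -> GL_Zp h ->
  y = g *m x *m h -> kl_double_coset w y = kl_double_coset w x.
Proof.
move=> gU gG hU hG yE; apply/seteqP; split=> _ [g' [g'U g'G] [h' [h'U h'G] <-]].
  exists (g' *m g); first by split; [apply: upper_unipM|apply: GL_ZpM].
  exists (h *m h'); first by split; [apply: unip_wM|apply: GL_ZpM].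
  exact: double_coset_fwd yE.
exists (g' *m invmx g); first by split; [apply: upper_unipM (upper_unipV _)|apply: GL_ZpM (GL_ZpV _)].
exists (invmx h *m h'); first by split; [apply: unip_wM (unip_wV _) _|apply: GL_ZpM (GL_ZpV _) _].
exact: double_coset_back (GL_Zp_unitmx gG) (GL_Zp_unitmx hG) yE.
Qed.

Lemma kl_quotientE :
  kl_double_coset w @` kl_set N = (kl_double_coset w \o cell) @` [set t | admissible t].
Proof.
apply/seteqP; split=> [_ [x xN <-]|_ [t tA <-]].
  have [t [g [h [tA gU gG [hU hG] tE]]]] := kl_set_cell xN.
  by exists t => //=; apply: kl_double_coset_eq tE.
exists (cell t) => //; split; last exact: cell_GL.
exists (cell_u t); first exact: cell_u_upper.
by exists (cell_heis t); [exact: heis_upper|exact: cellE].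
Qed.

Lemma mem_kl_double_coset x : kl_double_coset w x x.
Proof.
exists 1%:M; first by split; [exact: upper_unip1|exact: GL_Zp1].
exists 1%:M; last by rewrite mul1mx mulmx1.
split; last exact: GL_Zp1.
by apply/unip_wP; exists 0, 0, 0; rewrite /heis mx3_1 raddf0.
Qed.

Lemma cell_double_cosetP t y : admissible t -> kl_double_coset w (cell t) y ->
  exists g h, [/\ upper_unip g, GL_Zp g, unip_w w h, GL_Zp h &
    y = (g *m cell_u t) *m N *m (cell_heis t *m h)].
Proof.
move=> tA [g [gU gG] [h [hU hG] <-]]; exists g, h; split=> //.
exact: bruhat_mulmx (cellE p_pr tA).
Qed.

Lemma heis_GL_integral (a : 'rV[Qp]_m) b c : GL_Zp (heis a b c) ->
  [/\ integral a, integral b & c \in Zp_int].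
Proof.
move=> /GL_Zp_integral/mx3_over[[_ aZ cZ] [_ _ bZ] _]; split=> //.
by move: cZ => /mxOverP/(_ ord0 ord0); rewrite mxE mulr1n.
Qed.

Lemma liftF_diff_int (a b : 'F_p) (x : Qp) : x \in Zp_int ->
  p%:R^-1 * liftF a = p%:R^-1 * liftF b + x -> a = b.
Proof.
move=> xZ ab; apply/eqP; rewrite -(lift_Fp_inj p_pr) ![_ / _]mulrC.
by rewrite [X in X - _]ab addrAC subrr add0r.
Qed.

Lemma cell_double_coset_inj t t' : admissible t -> admissible t' ->
  kl_double_coset w (cell t) = kl_double_coset w (cell t') -> t = t'.
Proof.
move=> tA t'A tt'; have := mem_kl_double_coset (cell t); rewrite tt'.
move=> /(cell_double_cosetP t'A)[g [h [gU gG hU hG]]].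
move: hU hG => /unip_wP[a [b [c ->]]] /heis_GL_integral[aZ bZ cZ] yE.
have tE := etrans (etrans (cellE p_pr tA) yE)
  (congr1 (mulmx (g *m cell_u t' *m N)) (heisM _ _ _ a b c)).
have tU : cell_u t *m N *m cell_heis t \in unitmx.
  by rewrite (cellE p_pr tA); apply/GL_Zp_unitmx/cell_GL.
have [_ /heis_inj[AE BE CE]] :=
  cell_uniq (cell_u_upper p_pr tA) (upper_unipM gU (cell_u_upper p_pr t'A)) tU tE.
case: t t' {tt' yE tE tU tA t'A} AE BE CE => [C [B A]] [C' [B' A']] /= AE BE CE.
have AA : A = A'.
  apply/ffunP => j; have /mxOverP/(_ ord0 j) := aZ; move/matrixP/(_ ord0 j): AE.
  by rewrite !mxE => AE aj; apply: liftF_diff_int aj AE.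
have BB : B = B'.
  apply/ffunP => j; have /mxOverP/(_ j ord0) := bZ; move/matrixP/(_ j ord0): BE.
  by rewrite !mxE => BE bj; apply: liftF_diff_int bj BE.
(* The corner of the product contains the cross term [(A' / p) b], for which integrality of [b]
   would not suffice. Equality of the digits of [B] makes [b] exactly 0 and removes it. *)
have b0 : b = 0 by apply: (addrI (p%:R^-1 *: liftc B')); rewrite -BE BB addr0.
congr (_, (_, _)) => //; apply: liftF_diff_int cZ _.
by rewrite CE b0 mulmx0 mxE addr0.
Qed.

(** * Evaluation of the characters on the representatives *)

Context (R : realType).
Implicit Types psi : 'I_n -> int.
Local Notation CS := (C_star p_pr (fun _ : 'I_n => 1)).

Lemma unip_charM_int psi (g u : 'M[Qp]_n.+1) : upper_unip g -> upper_unip u ->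
  unip_char R psi (g *m u)
  = padic_char R (\sum_(j < n) (psi j)%:~R * g (widen_ord (leqnSn n) j) (lift ord0 j)
      + \sum_(j < n) (psi j)%:~R * u (widen_ord (leqnSn n) j) (lift ord0 j)).
Proof.
move=> gU uU; rewrite /unip_char -big_split /=; congr padic_char; apply: eq_bigr => j _.
by rewrite upper_unipM_super // mulrDr.
Qed.

Lemma super_sum_int psi (g : 'M[Qp]_n.+1) : integral g ->
  \sum_(j < n) (psi j)%:~R * g (widen_ord (leqnSn n) j) (lift ord0 j) \in Zp_int.
Proof.
by move=> /mxOverP gZ; apply: rpred_sum => j _; rewrite rpredM ?rpred_int.
Qed.

Lemma unip_char_GL_l psi (g u : 'M[Qp]_n.+1) : upper_unip g -> GL_Zp g -> upper_unip u ->
  unip_char R psi (g *m u) = unip_char R psi u.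
Proof.
move=> gU gG uU; rewrite unip_charM_int // addrC padic_charD_int //.
exact/super_sum_int/GL_Zp_integral.
Qed.

Lemma unip_char_GL_r psi (g u : 'M[Qp]_n.+1) : upper_unip u -> upper_unip g -> GL_Zp g ->
  unip_char R psi (u *m g) = unip_char R psi u.
Proof.
move=> uU gU gG; rewrite unip_charM_int // padic_charD_int //.
exact/super_sum_int/GL_Zp_integral.
Qed.

Lemma kl_term psi psi' t : admissible t ->
  (let uv := bruhat_decomp CS w (xget 0 (kl_double_coset w (cell t))) in
   unip_char R psi uv.1 * unip_char R psi' uv.2)
  = unip_char R psi (cell_u t) * unip_char R psi' (cell_heis t).
Proof.
move=> tA /=.
have /(xgetI (0 : 'M[Qp]_n.+1)) := mem_kl_double_coset (cell t).
move=> /(cell_double_cosetP tA)[g [h [gU gG hU hG]]].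
set y := xget _ _ => yE; rewrite /bruhat_decomp kl_matrixE.
have uU := cell_u_upper p_pr tA; have guU := upper_unipM gU uU.
(* The default value of [xget] is excluded by exhibiting the decomposition inherited from
   [cell t]. *)
case: xgetP => [[u v] _ /= [u1 v1 yE']|/(_ (g *m cell_u t, cell_heis t *m h))]; last first.
  by case; split; [exact: guU|apply: unip_wM; [exact: heis_unip_w|exact: hU]|exact: yE].
have yU : y \in unitmx.
  rewrite yE -(bruhat_mulmx g h (cellE p_pr tA)) !unitmx_mul (GL_Zp_unitmx gG) (GL_Zp_unitmx hG).
  by rewrite (GL_Zp_unitmx (cell_GL p_pr tA)).
have hup : upper_unip h by case: hU.
have [a [b [c hE]]] : exists a b c, cell_heis t *m h = heis a b c.
  by apply/unip_wP; apply: unip_wM; [exact: heis_unip_w|exact: hU].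
move: v1 => /unip_wP[a' [b' [c' vE]]].
rewrite hE in yE; rewrite vE in yE'.
have yU' := yU; rewrite yE in yU'.
have [uE heisE] := cell_uniq guU u1 yU' (etrans (esym yE) yE').
rewrite vE -heisE -hE -uE unip_char_GL_l //; congr (_ * _).
by apply: unip_char_GL_r; [exact: heis_upper|exact: hup|exact: hG].
Qed.

Lemma kloosterman_cells psi psi' :
  kloosterman R psi psi' CS w
  = \sum_(t | @admissible p k t) unip_char R psi (cell_u t) * unip_char R psi' (cell_heis t).
Proof.
rewrite /kloosterman /kl_quotient kl_matrixE kl_quotientE fsbig_image; last first.
  move=> t t'; rewrite !inE => tA t'A; exact: cell_double_coset_inj.
rewrite -big_enum /= [RHS]fsbig_seq ?enum_uniq //.
have -> : [set t | @admissible p k t] = [set` enum (@admissible p k)].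
  by apply/seteqP; split=> t /=; rewrite mem_enum.
apply: eq_fsbigr => t; rewrite inE /= mem_enum => tA.
exact: kl_term.
Qed.

Lemma big_ord_fst_mid_lst (U : nmodType) (G : 'I_n -> U) :
  \sum_(j < n) G j = G ord0 + (\sum_(i < k) G (lift ord0 (lshift 1 i))
    + G (lift ord0 (rshift k ord0))).
Proof.
rewrite (big_ord_recl (k + 1)); congr (_ + _).
by rewrite big_split_ord /= big_ord1.
Qed.

Lemma unip_char_mx3 (psi : 'I_n -> int) a (b : 'rV[Qp]_m) c d E f g h i :
  unip_char R psi (mx3 a b c d E f g h i) = padic_char R
    ((psi ord0)%:~R * b ord0 ord0
     + (\sum_(i < k) (psi (lift ord0 (lshift 1 i)))%:~R
           * E (widen_ord (leqnSn k) i) (lift ord0 i)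
        + (psi (lift ord0 (rshift k ord0)))%:~R * f ord_max ord0)).
Proof.
rewrite /unip_char big_ord_fst_mid_lst; congr (padic_char R (_ * _ + (_ + _ * _))).
- rewrite -(mx3E a b c d E f g h i); congr (mx3 _ _ _ _ _ _ _ _ _ _ _); exact: val_inj.
- apply: eq_bigr => j _; rewrite -(mx3E a b c d E f g h i); congr (_ * mx3 _ _ _ _ _ _ _ _ _ _ _);
    exact: val_inj.
- rewrite -(mx3E a b c d E f g h i); congr (mx3 _ _ _ _ _ _ _ _ _ _ _); apply: val_inj => //=.
  by rewrite addn0.
Qed.

Local Notation natZ a := ((nat_of_ord (a : 'F_p))%:R : Zp).

Lemma frac_natZ a : liftF a = frac (natZ a).
Proof. by rewrite rmorph_nat. Qed.

Lemma liftFV a : a != 0 -> (liftF a)^-1 = frac (natZ a)^-1.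
Proof. by move=> a0; rewrite frac_natZ rmorphV // lift_Fp_unit. Qed.

Lemma neq_widen_lift (i : 'I_k) : (widen_ord (leqnSn k) i == lift ord0 i) = false.
Proof. by rewrite -val_eqE /= /bump /= add1n ltn_eqF. Qed.

Lemma unip_char_cell_u psi C B A : C != 0 ->
  unip_char R psi (cell_u (C, (B, A))) = fp_char R
   ((psi ord0)%:~R * (- (-1) ^+ n * C^-1 * A ord0)
     + (\sum_(i < k) (psi (lift ord0 (lshift 1 i)))%:~R
           * (C^-1 * B (widen_ord (leqnSn k) i) * A (lift ord0 i))
        + (psi (lift ord0 (rshift k ord0)))%:~R * (C^-1 * B ord_max))).
Proof.
move=> C0; rewrite unip_char_mx3 /=.
(* This is [p] times the weighted superdiagonal sum of [cell_u]: the identity summand of its middle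
   block stays off the superdiagonal, so each term has denominator exactly one factor [p]. *)
pose z : Zp := (psi ord0)%:~R * (- (-1) ^+ n * (natZ C)^-1 * natZ (A ord0))
     + (\sum_(i < k) (psi (lift ord0 (lshift 1 i)))%:~R
           * ((natZ C)^-1 * natZ (B (widen_ord (leqnSn k) i)) * natZ (A (lift ord0 i)))
        + (psi (lift ord0 (rshift k ord0)))%:~R * ((natZ C)^-1 * natZ (B ord_max))).
have CV : (liftF C)^-1 = frac (natZ C)^-1 := liftFV C0.
transitivity (padic_char R (frac z / p%:R)).
  congr padic_char; rewrite /z 2!rmorphD !mulrDl; congr (_ + (_ + _)).
  - rewrite !mxE term_u CV !frac_natZ /eps.
    by rewrite !rmorphM rmorph_int rmorphN rmorphXn rmorphN1.
  - rewrite rmorph_sum mulr_suml; apply: eq_bigr => i _.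
    rewrite !mxE big_ord1 !mxE neq_widen_lift add0r term_E CV !frac_natZ.
    by rewrite !rmorphM rmorph_int.
  - rewrite !mxE term_v CV !frac_natZ.
    by rewrite !rmorphM rmorph_int.
rewrite padic_char_divp; congr fp_char; rewrite /z 2!rmorphD.
have resV : res_p (natZ C)^-1 = C^-1 by rewrite rmorphV ?lift_Fp_unit //= res_p_lift.
congr (_ + (_ + _)).
- by rewrite !rmorphM rmorph_int rmorphN rmorphXn rmorphN1 /= resV res_p_lift.
- rewrite rmorph_sum; apply: eq_bigr => i _.
  by rewrite !rmorphM rmorph_int /= resV !res_p_lift.
- by rewrite !rmorphM rmorph_int /= resV res_p_lift.
Qed.

Lemma unip_char_cell_heis psi C B A :
  unip_char R psi (cell_heis (C, (B, A))) = fp_char R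
   ((psi ord0)%:~R * A ord0 + (psi (lift ord0 (rshift k ord0)))%:~R * B ord_max).
Proof.
rewrite unip_char_mx3 /= big1 => [|i _]; last by rewrite mxE neq_widen_lift mulr0.
pose z : Zp := (psi ord0)%:~R * natZ (A ord0)
  + (psi (lift ord0 (rshift k ord0)))%:~R * natZ (B ord_max).
transitivity (padic_char R (frac z / p%:R)).
  congr padic_char; rewrite /z rmorphD mulrDl add0r !mxE !term_heis !frac_natZ.
  by rewrite !rmorphM !rmorph_int.
rewrite padic_char_divp; congr fp_char; rewrite /z rmorphD !rmorphM !rmorph_int /=.
by rewrite !res_p_lift.
Qed.

Lemma kloosterman_value psi psi' :
  (forall j : 'I_n, ~~ (p%:Z %| psi j * psi' j)%Z) ->
  kloosterman R psi psi' CS w = p%:R ^+ k.+1 + p%:R ^+ k.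
Proof.
move=> psi_ndvd.
have p_dvd (z : int) : (p%:Z %| z)%Z = (z%:~R == 0 :> 'F_p).
  exact: (dvdz_pcharf (pchar_Fp p_pr)).
have psi0 j : (psi j)%:~R != 0 :> 'F_p.
  by rewrite -p_dvd; apply: contra (psi_ndvd j) => /dvdz_mulr->.
have psi'0 j : (psi' j)%:~R != 0 :> 'F_p.
  by rewrite -p_dvd; apply: contra (psi_ndvd j) => /dvdz_mull->.
(* The sign comes from the entry [(-1)^n] of [w_star] through the first row of [cell_u]. *)
have al0 : - (-1) ^+ n * (psi ord0)%:~R != 0 :> 'F_p.
  by rewrite mulf_neq0 // oppr_eq0 signr_eq0.
rewrite kloosterman_cells -[p in RHS](card_Fp p_pr).
rewrite -(finite_kloosterman (fp_charD p_pr R) (fp_char0 p R) (fp_char1_neq1 p_pr R)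
  al0 (psi'0 ord0) (psi0 (lift ord0 (rshift k ord0))) (psi'0 (lift ord0 (rshift k ord0)))
  (fun i => psi0 (lift ord0 (lshift 1 i)))).
apply: eq_bigr => -[C [B A]] /andP[/= C0 _].
rewrite unip_char_cell_u // unip_char_cell_heis -fp_charD // /kl_phase; congr fp_char.
rewrite !addrA; congr (_ + _ + _ + _ + _).
- by ring.
- by apply: eq_bigr => i _; ring.
- by ring.
Qed.

End KloostermanCells.

Theorem corollary3 (R : realType) (p : nat) (p_pr : prime p) (n : nat)
    (n_ge2 : (2 <= n)%N) (psi psi' : 'I_n -> int)
    (psi_ndvd : forall j : 'I_n, ~~ (p%:Z %| psi j * psi' j)%Z)
    (wd : kl_well_defined R psi psi'
            (C_star p_pr (fun _ : 'I_n => 1)) (w_star p_pr n)) :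
  kloosterman R psi psi' (C_star p_pr (fun _ : 'I_n => 1)) (w_star p_pr n)
    = p%:R ^+ (n - 1) + p%:R ^+ (n - 2).
Proof.
(* The form [k.+1 + 1] makes [n.+1] the block size [1 + (m + 1)] with [m = k.+1], a nonempty middle
   block. *)
have [k nE] : exists k, n = (k.+1 + 1)%N.
  by exists (n - 2)%N; rewrite addn1 -addn2 subnK.
subst n; rewrite kloosterman_value //.
by rewrite addn1 subSS subn0 !subSS subn0.
Qed.
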